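(* Let $R$ be an extended affine root system with nullity $\nu$, let $R^\times$ be its set of anisotropic roots, and let $\mathcal W$ be its Weyl group (the extended affine Weyl group of $R$). Then $\mathcal W$ has a Coxeter presentation with respect to $R^\times$ if and only if $\nu<2$.
   Context: **Extended affine root systems (EARS).** Let $\mathcal V$ be a finite dimensional real vector space with a positive semi-definite symmetric bilinear form $(\cdot,\cdot)$ and let $R\subseteq\mathcal V$. Put $\mathcal V^0=\{v\in\mathcal V:(v,v)=0\}$, $R^0=R\cap\mathcal V^0$, $R^\times=R\setminus R^0$. $R$ is an extended affine root system in $\mathcal V$ if: (R1) $0\in R$; (R2) $-R=R$; (R3) $R$ spans $\mathcal V$; (R4) $\alpha\in R^\times\Rightarrow 2\alpha\notin R$; (R5) $R$ is discrete in $\mathcal V$; (R6) if $\alpha\in R^\times$, $\beta\in R$, there are $d,u\in\mathbb Z_{\ge0}$ with $\{\beta+n\alpha:n\in\mathbb Z\}\cap R=\{\beta-d\alpha,\dots,\beta+u\alpha\}$ and $d-u=2\frac{(\alpha,\beta)}{(\alpha,\alpha)}$; (R7) $R^\times$ is not a disjoint union of two nonempty subsets $R_1,R_2$ with $(R_1,R_2)=\{0\}$; (R8) for each $\sigma\in R^0$ there is $\alpha\in R^\times$ with $\alpha+\sigma\in R$. Elements of $R^\times$ are the anisotropic roots. The nullity of $R$ is $\dim\mathcal V^0$. **Extended affine Weyl group.** The image $\overline{R^\times}$ of $R^\times$ in $\mathcal V/\mathcal V^0$ is a finite crystallographic root system. Choose a fundamental system of it, preimages $\dot\alpha_1,\dots,\dot\alpha_l\in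 R^\times$ of its elements, and let $\dot{\mathcal V}=\mathrm{span}_{\mathbb R}\{\dot\alpha_1,\dots,\dot\alpha_l\}$, so $\mathcal V=\mathcal V^0\oplus\dot{\mathcal V}$. Let $V=\mathcal V^0\oplus\dot{\mathcal V}\oplus(\mathcal V^0)^*$ with the non-degenerate symmetric bilinear form $\langle(v_1,v_2,v_3),(u_1,u_2,u_3)\rangle=u_3(v_1)+(v_2,u_2)+v_3(u_1)$, which extends $(\cdot,\cdot)$ on $\mathcal V$. For $\alpha\in R^\times$ let $r_\alpha:V\to V$, $r_\alpha(v)=v-2\frac{\langle v,\alpha\rangle}{\langle\alpha,\alpha\rangle}\alpha$. The Weyl group $\mathcal W$ of $R$ is the subgroup of $\mathrm{Aut}(V)$ generated by $\{r_\alpha:\alpha\in R^\times\}$. **Coxeter presentation.** $\mathcal W$ has a Coxeter presentation with respect to $R^\times$ if there is a subset $\mathcal S\subseteq\{r_\alpha:\alpha\in R^\times\}$ such that $(\mathcal W,\mathcal S)$ is a Coxeter system. *)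

(* Defs.v *)
From HB Require Import structures.
From mathcomp Require Import all_boot all_order all_algebra.
From mathcomp Require Import sesquilinear ring.
From mathcomp Require Import all_classical all_reals all_analysis.

Set Implicit Arguments.
Unset Strict Implicit.
Unset Printing Implicit Defensive.

Import Order.TTheory GRing.Theory Num.Theory.
Import numFieldNormedType.Exports VectorInternalTheory.

Local Open Scope classical_set_scope.
Local Open Scope ring_scope.

(** * Generators, presentations and Coxeter systems *)

Section Presentations.
Local Open Scope group_scope.

Definition is_subgroup (G : groupType) (H : set G) : Prop :=
  [/\ H 1, (forall x y, H x -> H y -> H (x * y))
    & (forall x, H x -> H x^-1)].

Definition generated (G : groupType) (A : set G) : set G :=
  smallest (@is_subgroup G) A.

(* The letter (x, true) stands for the generator x, and (x, false) for its
   formal inverse. *)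
Definition word (X : Type) : Type := seq (X * bool).

(* Words modulo [pres_eq rel] form the group < X | rel >, i.e. the free group
   on X modulo the normal closure of the relators. *)
Inductive pres_eq (X : Type) (rel : set (word X)) : word X -> word X -> Prop :=
| pres_refl w : pres_eq rel w w
| pres_sym v w : pres_eq rel v w -> pres_eq rel w v
| pres_trans u v w : pres_eq rel u v -> pres_eq rel v w -> pres_eq rel u w
| pres_cat u u' v v' :
    pres_eq rel u u' -> pres_eq rel v v' -> pres_eq rel (u ++ v) (u' ++ v')
| pres_cancel x b : pres_eq rel [:: (x, b); (x, ~~ b)] [::]
| pres_rel r : rel r -> pres_eq rel r [::].

Definition eval_word (X : Type) (G : groupType) (f : X -> G) (w : word X) : G :=
  \prod_(p <- w) (if p.2 then f p.1 else (f p.1)^-1).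

(* The canonical map < X | rel > -> G given by f is well defined, injective,
   and has image W. *)
Definition presents (X : Type) (rel : set (word X)) (G : groupType)
    (f : X -> G) (W : set G) : Prop :=
  range (eval_word f) = W /\
  forall u v, eval_word f u = eval_word f v <-> pres_eq rel u v.

(* [None] is the entry infinity. *)
Definition coxeter_matrix (X : Type) (m : X -> X -> option nat) : Prop :=
  [/\ forall s, m s s = Some 1%N,
      forall s t, m s t = m t s
    & forall s t n, s <> t -> m s t = Some n -> (2 <= n)%N].

Definition coxeter_relators (X : Type) (m : X -> X -> option nat) :
    set (word X) :=
  [set w | exists s t n, m s t = Some n /\
     w = flatten (nseq n [:: (s, true); (t, true)])].

Definition coxeter_system (G : groupType) (W S : set G) : Prop :=
  exists m : set_type S -> set_type S -> option nat,
    coxeter_matrix m /\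
    presents (coxeter_relators m) (fun s : set_type S => val s) W.

End Presentations.

(** * The automorphism group of a finite-dimensional vector space *)

Section Aut.
Variables (K : fieldType) (E : vectType K).

Inductive aut_of : predArgType :=
  Aut (f : 'End(E)) of lker f == 0%VS.
Definition aut_val (g : aut_of) : 'End(E) := let: Aut f _ := g in f.

HB.instance Definition _ := [isSub for aut_val].
HB.instance Definition _ := [Choice of aut_of by <:].

Fact aut_one_proof : lker (\1%VF : 'End(E)) == 0%VS.
Proof. by apply/lker0P => u v; rewrite !lfunE. Qed.
Definition aut_one := Aut aut_one_proof.

Fact aut_mul_proof (g h : aut_of) : lker (aut_val g \o aut_val h)%VF == 0%VS.
Proof.
case: g h => g /lker0P gI [h /lker0P hI] /=.
by apply/lker0P => u v; rewrite !comp_lfunE => /gI/hI.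
Qed.
Definition aut_mul g h := Aut (aut_mul_proof g h).

Fact aut_inv_proof (g : aut_of) : lker (aut_val g)^-1%VF == 0%VS.
Proof.
case: g => g g0 /=; apply/lker0P => u v /(congr1 g).
by rewrite !lker0_lfunVK.
Qed.
Definition aut_inv g := Aut (aut_inv_proof g).

Fact aut_mulA : associative aut_mul.
Proof. by move=> f g h; apply: val_inj; rewrite /= comp_lfunA. Qed.
Fact aut_mul1 : left_id aut_one aut_mul.
Proof. by move=> f; apply: val_inj; rewrite /= comp_lfun1l. Qed.
Fact aut_mulr1 : right_id aut_one aut_mul.
Proof. by move=> f; apply: val_inj; rewrite /= comp_lfun1r. Qed.
Fact aut_mulV : left_inverse aut_one aut_inv aut_mul.
Proof. by case=> f f0; apply: val_inj; rewrite /= lker0_compVf. Qed.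
Fact aut_mulrV : right_inverse aut_one aut_inv aut_mul.
Proof. by case=> f f0; apply: val_inj; rewrite /= lker0_compfV. Qed.

HB.instance Definition _ :=
  isGroup.Build aut_of aut_mulA aut_mul1 aut_mulr1 aut_mulV aut_mulrV.

End Aut.

(** * Quotients of vector spaces and fundamental systems *)

Section Quotient.
Variables (K : fieldType) (V : vectType K) (U : {vspace V}).

(* The library has no quotient of a vectType: V/U is realized on the chosen
   complement of U, the canonical surjection being the projection along U. *)
Definition quotv : vectType K := subvs_of (U^C)%VS.
Definition to_quotv (v : V) : quotv := vsproj (U^C)%VS (daddv_pi (U^C)%VS U v).

Lemma to_quotv_linear : linear to_quotv.
Proof. by move=> c u v; rewrite /to_quotv !linearP. Qed.

Lemma to_quotv_surj (q : quotv) : exists v, to_quotv v = q.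
Proof.
exists (vsval q); rewrite /to_quotv daddv_pi_id ?vsvalK ?subvsP //.
by rewrite capvC capv_compl.
Qed.

Lemma to_quotv_eq0 v : (to_quotv v = 0) <-> (v \in U).
Proof.
have disj : ((U^C)%VS :&: U = 0)%VS by rewrite capvC capv_compl.
have full : (v \in U^C + U)%VS by rewrite addvC addv_complf memvf.
have vE := daddv_pi_add disj full; split.
  move=> /(congr1 vsval); rewrite vsprojK ?memv_pi //= => v0.
  by rewrite -vE v0 ?linear0 add0r memv_pi.
move=> vU; have disj' : (U :&: (U^C)%VS = 0)%VS by rewrite capv_compl.
move: vE; rewrite (daddv_pi_id disj' vU) => /(canRL (addrK _)).
by rewrite subrr /to_quotv => ->; rewrite linear0.
Qed.

End Quotient.

Definition fundamental_system (K : realFieldType) (E : vectType K)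
    (Phi : set E) (b : seq E) : Prop :=
  [/\ basis_of fullv b,
      (forall x, x \in b -> Phi x)
    & forall x, Phi x -> exists c : 'I_(size b) -> nat,
        x = \sum_(i < size b) b`_i *+ c i \/
        x = - \sum_(i < size b) b`_i *+ c i].

(** * Extended affine root systems *)

Definition discrete_set (T : topologicalType) (A : set T) : Prop :=
  A `<=` isolated A.

Section EARS.
Variables (K : realType) (V : vectType K) (B : {symmetric V}).
Implicit Types (R : set V) (v : V).

Definition positive_semidefinite : Prop := forall v, 0 <= B v v.

Definition isotropic : set V := [set v | B v v = 0].

Definition isotropic_roots R : set V := R `&` isotropic.
Definition anisotropic_roots R : set V := R `\` isotropic.

Record is_EARS R : Prop := IsEARS {
  ears_0 : R 0;
  ears_opp : [set - v | v in R] = R;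
  ears_span : forall U : {vspace V}, (forall v, R v -> v \in U) -> U = fullv;
  ears_reduced : forall alpha, anisotropic_roots R alpha -> ~ R (alpha *+ 2);
  (* the topology of V is transported from K^n by a linear isomorphism *)
  ears_discrete : discrete_set [set (v2r v : 'rV[K]_(dim V)) | v in R];
  ears_string : forall alpha beta, anisotropic_roots R alpha -> R beta ->
    exists d u : nat,
      [set beta + alpha *~ n | n in [set: int]] `&` R =
        [set beta + alpha *~ n | n in [set n : int | - d%:Z <= n <= u%:Z]] /\
      d%:R - u%:R = 2%:R * (B alpha beta / B alpha alpha);
  ears_irreducible : ~ exists R1 R2 : set V,
    [/\ R1 !=set0, R2 !=set0, R1 `&` R2 = set0,
        R1 `|` R2 = anisotropic_roots R
      & forall x y, R1 x -> R2 y -> B x y = 0];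
  ears_isotropic : forall sigma, isotropic_roots R sigma ->
    exists alpha, anisotropic_roots R alpha /\ R (alpha + sigma)
}.

(* V^0 as a subspace; [mem_isotropic_space] identifies it with [isotropic]. *)
Definition isotropic_space : {vspace V} := orthov B fullv.

Lemma mem_isotropic_space : positive_semidefinite ->
  forall v, (v \in isotropic_space) <-> isotropic v.
Proof.
move=> B_ge0 v; split=> [/mem_orthovP/(_ v (memvf v))//|/= Bvv].
apply/mem_orthovP => w _; apply: contrapT => /eqP Bvw.
have Bwv : B w v = B v w by rewrite hermC expr0 mul1r.
have expand t : B (t *: v + w) (t *: v + w) = t * B v w *+ 2 + B w w.
  rewrite linearDl !linearDr /= !linearZl_LR !linearZr_LR /= Bvv Bwv.
  by rewrite mulr0 scaler0 add0r mulr2n addrA.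
have := B_ge0 (- (B w w + 1) / (B v w *+ 2) *: v + w).
rewrite expand -mulrnAr mulfVK ?mulrn_eq0 //.
by rewrite opprD addrAC addNr add0r oppr_ge0 leNgt ltr01.
Qed.

Definition nullity : nat := \dim isotropic_space.

(* [a] lists preimages in R^x of a fundamental system of the image of R^x in
   V / V^0. *)
Definition fundamental_lift R (l : nat) (a : l.-tuple V) : Prop :=
  (forall i, anisotropic_roots R (tnth a i)) /\
  fundamental_system (@to_quotv _ _ isotropic_space @` anisotropic_roots R)
    [seq to_quotv isotropic_space v | v <- a].

Section Hyperbolic.
Variable Vdot : {vspace V}.

Definition hyperbolic : vectType K :=
  (subvs_of isotropic_space * subvs_of Vdot *
   'Hom(subvs_of isotropic_space, K^o))%type.

Definition hform (v u : hyperbolic) : K :=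
  u.2 v.1.1 + B (vsval v.1.2) (vsval u.1.2) + v.2 u.1.1.

(* The inclusion of V = V^0 (+) Vdot. *)
Definition hincl (v : V) : hyperbolic :=
  (vsproj isotropic_space (daddv_pi isotropic_space Vdot v),
   vsproj Vdot (daddv_pi Vdot isotropic_space v),
   0).

Definition reflection_fun (alpha v : hyperbolic) : hyperbolic :=
  v - (2%:R * (hform v alpha / hform alpha alpha)) *: alpha.

Fact hform_linear (alpha : hyperbolic) (c : K) (u v : hyperbolic) :
  hform (c *: u + v) alpha = c * hform u alpha + hform v alpha.
Proof.
rewrite /hform /= !linearP /= linearDl linearZl_LR /= add_lfunE scale_lfunE.
by rewrite !mulrDr !addrA [LHS](ACl (1*3*5*2*4*6)).
Qed.

Fact reflection_linear (alpha : hyperbolic) : linear (reflection_fun alpha).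
Proof.
move=> c u v; rewrite /reflection_fun hform_linear scalerBr scalerA addrACA.
by rewrite -opprD -scalerDl; congr (_ - _ *: _); ring.
Qed.

HB.instance Definition _ (alpha : hyperbolic) :=
  GRing.isLinear.Build K hyperbolic hyperbolic *:%R (reflection_fun alpha)
    (reflection_linear alpha).

Fact reflection_involutive (alpha : hyperbolic) :
  involutive (reflection_fun alpha).
Proof.
move=> v; set h := hform v alpha; set N := hform alpha alpha.
have hr : hform (reflection_fun alpha v) alpha = h - 2%:R * (h / N) * N.
  by rewrite /reflection_fun addrC -scaleNr hform_linear mulNr addrC.
rewrite {1}/reflection_fun hr -/N /reflection_fun -/h -/N -addrA -opprD.
rewrite -scalerDl -mulrDr -mulrDl.
have [->|N0] := eqVneq N 0; first by rewrite invr0 !mulr0 scale0r subr0.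
suff -> : h + (h - 2%:R * (h / N) * N) = 0 by rewrite mul0r mulr0 scale0r subr0.
by field.
Qed.

Fact reflection_proof (alpha : hyperbolic) :
  lker (linfun (reflection_fun alpha)) == 0%VS.
Proof.
apply/lker0P => u v; rewrite !lfunE /=.
exact: (inv_inj (@reflection_involutive alpha)).
Qed.

Definition reflection (alpha : hyperbolic) : aut_of hyperbolic :=
  Aut (reflection_proof alpha).

Definition root_reflections R : set (aut_of hyperbolic) :=
  [set reflection (hincl alpha) | alpha in anisotropic_roots R].

Definition weyl_group R : set (aut_of hyperbolic) :=
  generated (root_reflections R).

Definition has_coxeter_presentation R : Prop :=
  exists S : set (aut_of hyperbolic),
    S `<=` root_reflections R /\ coxeter_system (weyl_group R) S.

End Hyperbolic.
End EARS.

(* Main.v *)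
From HB Require Import structures.
Require Import Defs.
From mathcomp Require Import all_boot all_order all_algebra.
From mathcomp Require Import sesquilinear ring lra zify.
From mathcomp Require Import all_classical all_reals all_analysis.

(** If nu < 2, there is a linear functional f on V with |f| >= 1 on all nonzero
    roots: the sum of the coefficients with respect to the fundamental system,
    plus a large multiple of the coordinate along V^0, which is bounded away
    from 0 when it does not vanish because R is discrete and R^x meets finitely
    many classes modulo V^0. The indecomposable anisotropic roots of the
    half-space f > 0 behave as the simple roots of a finite root system: their
    reflections generate W, and counting inversions yields the deletion
    condition, which forces the Coxeter relations to present W.

    If nu >= 2, there are anisotropic roots x, x + s, y, y + t with (x, y) <> 0
    and s, t linearly independent in V^0. The commutator of r_{x+s} r_x and
    r_{y+t} r_y is central in W and of infinite order, whereas a central element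
    of a Coxeter group squares to 1. *)

Set Implicit Arguments.
Unset Strict Implicit.
Unset Printing Implicit Defensive.

Import Order.TTheory GRing.Theory Num.Theory.
Import numFieldNormedType.Exports VectorInternalTheory.

Local Open Scope classical_set_scope.
Local Open Scope ring_scope.

(** * Coxeter systems *)

(** For nullity 1 the root system may be infinite, so the usual inductions on height need a
    substitute: the bound [|f| >= 1] makes every decomposition of a positive root finite and every
    lowering by a simple reflection cost at least one unit. Isotropic roots must satisfy the bound
    too, because root strings through anisotropic roots can contain them.

    Deletion gives the presentation through a shortest relation that would not follow from the
    Coxeter relators: its halves, and those of its rotations, are compared until its letters are
    seen to alternate, and an alternating relation does follow from them.

    For nullity at least 2, the commutator is [u |-> u + k (<u,s> t - <u,t> s)] with [k <> 0].
    Anisotropic reflections fix [s] and [t], whence centrality. It is the identity on the image of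
    [V]; only the summand dual to [V^0] shows that it is nontrivial, which is why the group has to
    act on the hyperbolic extension. *)

Section InvolutiveGenerators.
Local Open Scope group_scope.
Variables (G : groupType) (X : Type) (f : X -> G).
Hypothesis f_inv : forall s, f s * f s = 1.

Definition ev (x : seq X) : G := \prod_(s <- x) f s.

Lemma ev_nil : ev [::] = 1. Proof. exact: big_nil. Qed.

Lemma ev_cons s x : ev (s :: x) = f s * ev x. Proof. exact: big_cons. Qed.

Lemma ev_cat x y : ev (x ++ y) = ev x * ev y. Proof. exact: big_cat. Qed.

Lemma ev_seq1 s : ev [:: s] = f s. Proof. exact: big_seq1. Qed.

Lemma gen_invg s : (f s)^-1 = f s.
Proof. exact: mulg1_eq. Qed.

Lemma ev_rev x : ev (rev x) = (ev x)^-1.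
Proof.
elim: x => [|s x IH]; first by rewrite ev_nil invg1.
by rewrite rev_cons -cats1 ev_cat ev_seq1 ev_cons invgM IH gen_invg.
Qed.

Lemma eval_wordE (w : word X) : eval_word f w = ev (map fst w).
Proof.
rewrite /eval_word /ev big_map; apply: eq_bigr => -[s []] _ //=.
exact: gen_invg.
Qed.

Lemma flatten_nseq2 n (s t : X) :
  map fst (flatten (nseq n [:: (s, true); (t, true)])) =
  flatten (nseq n [:: s; t]).
Proof. by elim: n => //= n ->. Qed.

Lemma ev_alternating n s t :
  ev (flatten (nseq n [:: s; t])) = (f s * f t) ^+ n.
Proof.
elim: n => [|n IH]; first by rewrite ev_nil.
by rewrite /= !ev_cons IH expgS mulgA.
Qed.

(** The conjugates [p s p^-1] of the letters [s] by the prefixes [p] before them. In a Coxeter group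
    their multiplicities modulo 2 depend only on the product of the word. *)
Fixpoint refls (x : seq X) : seq G :=
  if x is s :: x' then f s :: [seq t ^ f s | t <- refls x'] else [::].

Lemma refls_cat x y :
  refls (x ++ y) = refls x ++ [seq t ^ (ev x)^-1 | t <- refls y].
Proof.
elim: x => [|s x IH] /=.
  by rewrite ev_nil invg1 map_id_in // => t _; rewrite conjg1.
rewrite IH map_cat -map_comp; congr (_ :: (_ ++ _)).
by apply: eq_map => t; rewrite /= ev_cons invgM gen_invg conjgM.
Qed.

Lemma count_refls_cat t x y :
  count_mem t (refls (x ++ y)) =
  (count_mem t (refls x) + count_mem (t ^ ev x)%g (refls y))%N.
Proof.
rewrite refls_cat count_cat count_map; congr (_ + _)%N; apply: eq_count => r /=.
by apply/eqP/eqP => [<-|->]; rewrite ?conjgKV ?conjgK.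
Qed.

Lemma refls_alternating n s t :
  refls (flatten (nseq n [:: s; t])) =
  mkseq (fun i => (f s * f t) ^+ i * f s) n.*2.
Proof.
elim: n => [|n IH] //=; rewrite IH /mkseq doubleS /=.
rewrite expg0 mul1g expg1 conjgE gen_invg; congr [:: _, _ & _].
  by rewrite mulgA.
rewrite -map_comp (iotaDl 2 0) -!map_comp; apply: eq_map => i /=.
rewrite -conjgM conjgE invgM !gen_invg add2n.
by rewrite expgS expgSr !mulgA.
Qed.

Lemma refls_alternating_even n s t r : (f s * f t) ^+ n = 1 ->
  ~~ odd (count_mem r (refls (flatten (nseq n [:: s; t])))).
Proof.
move=> st1; rewrite refls_alternating -addnn /mkseq iotaD map_cat count_cat.
rewrite add0n -{2}(addn0 n) iotaDl -map_comp.
rewrite (@eq_map _ _ _ (fun i => (f s * f t) ^+ i * f s)) ?addnn ?odd_double//.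
by move=> i /=; rewrite expgnDr st1 mul1g.
Qed.

Lemma mem_refls (t : G) x : t \in refls x ->
  exists p r q, x = p ++ r :: q /\ t * ev p = ev p * f r.
Proof.
elim: x t => [//|s x IH] t /=; rewrite inE => /orP[/eqP ->|/mapP[r]].
  by exists [::], s, x; rewrite ev_nil mulg1 mul1g.
move=> /IH[p [a [q [-> pq]]]] ->; exists (s :: p), a, q; split => //.
by rewrite ev_cons conjgE gen_invg -!mulgA (mulgA (f s) (f s)) f_inv mul1g pq.
Qed.

(** Two equal entries come from two letters that cancel: the first one, moved past the letters
    between them, becomes the second. *)
Lemma shorten_ev x : ~~ uniq (refls x) ->
  exists y, (size y < size x)%N /\ ev y = ev x.
Proof.
elim: x => [//|s x IH] /=; rewrite negb_and negbK => /orP[/mapP[t tx]|].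
  move=> /(congr1 (fun t => t ^ (f s)^-1)); rewrite conjgK => ts.
  have {ts} ts : t = f s by rewrite -ts conjgE invgK gen_invg f_inv mulg1.
  have [p [r [q [-> pq]]]] := mem_refls tx; exists (p ++ q).
  rewrite !size_cat /= !addnS; split; first by rewrite ltnW.
  by rewrite ev_cons !ev_cat ev_cons (mulgA (ev p)) -pq ts !mulgA f_inv mul1g.
rewrite map_inj_uniq; last exact: conjg_inj.
move=> /IH[y [yx yE]]; exists (s :: y); rewrite !ev_cons yE; split => //.
Qed.

End InvolutiveGenerators.

(** * Central elements of a Coxeter group *)

Section CoxeterCenter.
Local Open Scope group_scope.
Variables (G : groupType) (W S : set G).

(* Invariance holds relator by relator: when (s t)^n = 1, the reflections of the
   word (s t)^n form a list of length n repeated twice. *)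
Lemma coxeter_refls_parity (m : set_type S -> set_type S -> option nat) :
  coxeter_matrix m ->
  presents (coxeter_relators m) (fun s : set_type S => val s) W ->
  (forall s : set_type S, val s * val s = 1) /\
  forall (x y : seq (set_type S)) (t : G),
    ev (fun s : set_type S => val s) x = ev (fun s : set_type S => val s) y ->
    odd (count_mem t (refls (fun s : set_type S => val s) x)) =
    odd (count_mem t (refls (fun s : set_type S => val s) y)).
Proof.
move=> [m1 _ _] [_ pres]; set f := fun s : set_type S => val s.
have eval_rel s t n : m s t = Some n -> (f s * f t) ^+ n = 1.
  move=> mst; have : eval_word f (flatten (nseq n [:: (s, true); (t, true)]))
                   = eval_word f [::].
    by apply/pres; apply: pres_rel; exists s, t, n.
  rewrite {2}/eval_word big_nil => <-; elim: n {mst} => [|n IH].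
    by rewrite /eval_word big_nil.
  by rewrite expgS IH /eval_word /= !big_cons mulgA.
have f_inv s : f s * f s = 1 by rewrite -[LHS]expg1 (eval_rel s s).
split=> // x y t exy.
suff parity (u v : word (set_type S)) : pres_eq (coxeter_relators m) u v ->
    eval_word f u = eval_word f v /\ forall t,
    odd (count_mem t (refls f (map fst u))) =
    odd (count_mem t (refls f (map fst v))).
  have : pres_eq (coxeter_relators m) [seq (s, true) | s <- x]
                                      [seq (s, true) | s <- y].
    by apply/pres; rewrite !eval_wordE // -!map_comp !map_id.
  by move=> /parity[_ /(_ t)]; rewrite -!map_comp !map_id.
elim=> {u v x y t exy}.
- by [].
- by move=> u v _ [-> uv]; split.
- by move=> u v w _ [-> uv] _ [-> vw]; split => // t; rewrite uv.
- move=> u u' v v' _ [eu cu] _ [ev cv]; split.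
    by rewrite !eval_wordE // !map_cat !ev_cat -!eval_wordE // eu ev.
  move=> t; rewrite !map_cat !count_refls_cat // !oddD cu cv.
  by rewrite -!eval_wordE // eu.
- move=> s b; split=> [|t /=].
    by rewrite eval_wordE //= !ev_cons ev_nil mulg1 f_inv /eval_word big_nil.
  have -> : f s ^ f s = f s by rewrite conjgE mulKg.
  by rewrite addn0 addnn odd_double.
- move=> _ [s [t [n [mst ->]]]]; split.
    rewrite eval_wordE // flatten_nseq2 ev_alternating (eval_rel _ _ _ mst).
    by rewrite /eval_word big_nil.
  move=> r; rewrite flatten_nseq2 /=; apply/negbTE.
  exact/refls_alternating_even/eval_rel.
Qed.

(* With z = [ev u], centrality makes each reflection occur an even number of
   times in [refls (u ++ u)], whereas the reflections of a shortest word for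
   z ^ 2 are pairwise distinct. *)
Lemma coxeter_center_involutive z : coxeter_system W S -> W z ->
  (forall w, W w -> w * z = z * w) -> z * z = 1.
Proof.
move=> [m [mP pres]] Wz zC; have [f_inv parity] := coxeter_refls_parity mP pres.
set f := (fun s : set_type S => val s) in f_inv parity.
have Wev x : W (ev f x).
  case: pres => <- _; exists [seq (s, true) | s <- x] => //.
  by rewrite eval_wordE // -map_comp map_id.
have [u uz] : exists u, ev f u = z.
  case: pres => WE _; move: Wz; rewrite -WE => -[w _ <-].
  by exists (map fst w); rewrite eval_wordE.
pose P n := `[< exists x, size x = n /\ ev f x = z * z >].
have exP : exists n, P n.
  by exists (size (u ++ u)); apply/asboolP; exists (u ++ u); rewrite ev_cat uz.
case: (ex_minnP exP) => k /asboolP[x [<- xz]] xmin.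
have [/eqP|x_neq0] := eqVneq (size x) 0%N.
  by case: x xz {xmin} => //; rewrite ev_nil.
have xU : uniq (refls f x).
  apply: contrapT => /negP/(shorten_ev f_inv)[y [yx yE]].
  suff /xmin : P (size y) by rewrite leqNgt yx.
  by apply/asboolP; exists y; rewrite yE.
case: x xz x_neq0 {xmin} xU => [//|s x] xz _ xU.
have := parity (s :: x) (u ++ u) (f s).
rewrite ev_cat uz xz count_refls_cat // uz.
have -> : f s ^ z = f s.
  by rewrite conjgE zC ?mulKg// -ev_seq1; exact: Wev.
rewrite count_uniq_mem // mem_head addnn odd_double /=.
by move=> /(_ erefl).
Qed.

End CoxeterCenter.

(** * From the deletion condition to the Coxeter presentation *)

Section DeletionCondition.
Local Open Scope group_scope.
Variables (G : groupType) (X : Type) (f : X -> G).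
Hypotheses (f_inv : forall s, f s * f s = 1) (f_inj : injective f).

Definition order_matrix (s t : X) : option nat :=
  match pselect (exists n, (0 < n)%N && ((f s * f t) ^+ n == 1)) with
  | left stn => Some (ex_minn stn)
  | right _ => None
  end.

Lemma order_matrix_Some s t n : order_matrix s t = Some n ->
  [/\ (0 < n)%N, (f s * f t) ^+ n = 1
    & forall k, (0 < k)%N -> (f s * f t) ^+ k = 1 -> (n <= k)%N].
Proof.
rewrite /order_matrix; case: pselect => // stn [<-].
case: ex_minnP => k /andP[k0 /eqP stk] kmin; split => // i i0 /eqP sti.
by apply: kmin; rewrite i0.
Qed.

Lemma order_matrix_dvd s t n : (0 < n)%N -> (f s * f t) ^+ n = 1 ->
  exists2 k, order_matrix s t = Some k & (k %| n)%N.
Proof.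
move=> n0 stn; case mst: (order_matrix s t) => [k|]; last first.
  move: mst; rewrite /order_matrix; case: pselect => // -[].
  by exists n; rewrite n0 stn eqxx.
exists k => //; have [k0 stk kmin] := order_matrix_Some mst.
rewrite /dvdn; have [//|r0] := posnP (n %% k)%N.
suff /(kmin _ r0) : (f s * f t) ^+ (n %% k) = 1 by rewrite leqNgt ltn_mod k0.
by rewrite -stn {2}(divn_eq n k) expgnDr mulnC expgnA stk expg1n mul1g.
Qed.

Lemma order_matrix_coxeter : coxeter_matrix order_matrix.
Proof.
split=> [s|s t|s t n st mst].
- have [k mss] := @order_matrix_dvd s s 1 isT (f_inv s).
  by rewrite dvdn1 => /eqP <-.
- have sub a b n : order_matrix a b = Some n ->
    exists2 k, order_matrix b a = Some k & (k <= n)%N.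
    move=> /order_matrix_Some[n0 abn _].
    have [|k mk kn] := @order_matrix_dvd b a n n0; last first.
      by exists k => //; exact: dvdn_leq.
    by apply: invg_inj; rewrite -expVgn invgM !(gen_invg f_inv) abn invg1.
  case mst: (order_matrix s t) => [n|].
    have [k mts kn] := sub _ _ _ mst; have [n' mst' nk] := sub _ _ _ mts.
    move: mst'; rewrite mst => -[?]; subst n'.
    by rewrite mts; congr Some; apply/eqP; rewrite eqn_leq nk.
  case mts: (order_matrix t s) => [n|//].
  by have [k] := sub _ _ _ mts; rewrite mst.
- have [n0 stn _] := order_matrix_Some mst.
  case: n n0 stn {mst} => [|[|n]] // _ st1; case: st; apply: f_inj.
  by rewrite -[LHS]mulg1 -(f_inv t) mulgA (st1 : f s * f t = 1) mul1g.
Qed.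

Definition letters (x : seq X) : word X := [seq (s, true) | s <- x].

Let rel := coxeter_relators order_matrix.
Local Notation "x =w y" := (pres_eq rel (letters x) (letters y)) (at level 70).

Lemma letters_cat x y : letters (x ++ y) = letters x ++ letters y.
Proof. exact: map_cat. Qed.

Lemma eqw_cat x x' y y' : x =w x' -> y =w y' -> x ++ y =w x' ++ y'.
Proof. by move=> xx' yy'; rewrite !letters_cat; exact: pres_cat. Qed.

Lemma eqw_catl x y y' : y =w y' -> x ++ y =w x ++ y'.
Proof. by move=> yy'; apply: eqw_cat => //; exact: pres_refl. Qed.

Lemma eqw_catr x x' y : x =w x' -> x ++ y =w x' ++ y.
Proof. by move=> xx'; apply: eqw_cat => //; exact: pres_refl. Qed.

Lemma eqw_alternating s t n : (f s * f t) ^+ n = 1 ->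
  flatten (nseq n [:: s; t]) =w [::].
Proof.
case: (posnP n) => [-> _|n0 stn]; first exact: pres_refl.
have [k mst /dvdnP[i ->]] := order_matrix_dvd n0 stn.
have k_triv : flatten (nseq k [:: s; t]) =w [::].
  apply: pres_rel; exists s, t, k; split => //.
  by elim: k {mst} => //= k ->.
elim: i => [|i IH]; first exact: pres_refl.
rewrite mulSn nseqD flatten_cat; exact: (eqw_cat k_triv IH).
Qed.

Lemma eqw_invol s : [:: s; s] =w [::].
Proof. exact: (@eqw_alternating s s 1 (f_inv s)). Qed.

Lemma eqw_rev x : rev x ++ x =w [::].
Proof.
elim: x => [|s x IH]; first exact: pres_refl.
rewrite rev_cons cat_rcons; apply: pres_trans IH; apply: eqw_catl.
exact: (eqw_catr x (eqw_invol s)).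
Qed.

Lemma eqw_move x y z : x ++ rev y =w z -> x =w z ++ y.
Proof.
move=> xyz; apply: (@pres_trans _ _ _ (letters (x ++ rev y ++ y))).
  by rewrite -{1}[x]cats0; apply/eqw_catl/pres_sym/eqw_rev.
by rewrite catA; exact: (eqw_catr y xyz).
Qed.

Lemma eqw_cons s x y : s :: x =w y -> x =w s :: y.
Proof.
move=> xy; apply: pres_trans (eqw_catl [:: s] xy).
exact/pres_sym/(eqw_catr x (eqw_invol s)).
Qed.

Hypothesis deletion : forall x y,
  ev f x = ev f y -> (size y < size x)%N ->
  exists x1 a x2 b x3, x = x1 ++ a :: x2 ++ b :: x3 /\
    ev f (rcons x2 b) = ev f (a :: x2).

Section MinimalRelation.
Variable n : nat.
Hypothesis short_triv : forall y, (size y < n)%N -> ev f y = 1 -> y =w [::].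

(** A relation of length [n] that is no consequence of the Coxeter relators, while all shorter ones
    are. The section refutes its existence. *)
Let bad x := [/\ size x = n, ev f x = 1 & ~ (x =w [::])].

Lemma short_eqw u v : (size u + size v < n)%N -> ev f u = ev f v -> u =w v.
Proof.
move=> uv euv; apply/(@eqw_move _ _ [::])/short_triv.
  by rewrite size_cat size_rev.
by rewrite ev_cat ev_rev // euv mulgV.
Qed.

Lemma bad_rot x i : bad x -> bad (rot i x).
Proof.
move=> [xn x1 xt]; split; first by rewrite size_rot.
  rewrite -[x](cat_take_drop i) ev_cat in x1.
  by rewrite /rot ev_cat -(mulg1_eq x1) mulVg.
move=> xt'; apply: xt; rewrite -[x](cat_take_drop i).
apply: pres_trans (eqw_rev (rev (take i x))); rewrite revK; apply: eqw_catl.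
by apply: (@eqw_move _ _ [::]); rewrite revK.
Qed.

(* Comparing the first half of a bad relation with the inverse of the second
   half, deletion would split the relation into shorter ones unless the deleted
   letters are the first and the last of the first half. Applied to rotations
   and to the relation deduced from it, this makes the letters alternate. *)
Lemma bad_half x : bad x -> exists a y b w,
  [/\ x = a :: y ++ b :: w, size y = size w
    & ev f (rcons y b) = ev f (a :: y)].
Proof.
move=> [xn x1 xt]; pose u := take n./2.+1 x; pose w := drop n./2.+1 x.
have xE : x = u ++ w by rewrite cat_take_drop.
have n0 : (0 < n)%N.
  by rewrite -xn; case: (x) xt => // -[]; exact: pres_refl.
have hn : (odd n + n./2.*2 = n)%N := odd_double_half n.
have su : size u = n./2.+1 by rewrite /u size_takel // xn; lia.
have sw : (size w = n - n./2.+1)%N by rewrite /w size_drop xn.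
have euw : ev f u = ev f (rev w).
  by rewrite ev_rev //; rewrite xE ev_cat in x1; rewrite -(mulg1_eq x1) invgK.
have [|x1' [a [y [b [x3 [uE aE]]]]]] := deletion euw.
  by rewrite size_rev su sw; lia.
(* The relation [rcons y b = a :: y] has length [(size y).+1.*2]. If this is at least [n], then [n]
   is even and [a], [b] are the two ends of [u], since [u] has only [n./2.+1] letters. *)
have [yn|yn] := ltnP (size y).+1.*2 n.
  case: xt; rewrite xE uE.
  have ayb : a :: rcons y b =w y.
    apply/pres_sym/eqw_cons/pres_sym/short_eqw => //=.
    by rewrite size_rcons; lia.
  have : x1' ++ y ++ x3 ++ w =w [::].
    apply: short_triv.
      rewrite -xn xE uE !size_cat /= !size_cat /=; lia.
    have ay : f a * (ev f y * f b) = ev f y.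
      by rewrite -(ev_seq1 f b) -ev_cat cats1 aE ev_cons mulgA f_inv mul1g.
    rewrite -x1 xE uE !ev_cat -{1}ay ev_cons ev_cat ev_cons.
    by rewrite !mulgA.
  move=> sh; apply: pres_trans sh; rewrite -(cat_rcons b y) -cat_cons -!catA.
  exact/eqw_catl/eqw_catr.
move: (su); rewrite {1}uE !size_cat /= !size_cat /= => su'.
have [x10 x30 yw] : [/\ x1' = [::], x3 = [::] & size y = size w].
  by split; [apply: size0nil| apply: size0nil|]; lia.
exists a, y, b, w; split => //.
by rewrite xE uE x10 x30 /= -catA.
Qed.

(** [bad_half] for the word and for its rotation by one letter gives [c y' b = a c y'] and
    [y' b e = c y' b]. The second equation rearranges into another relation [x'] of length [n],
    beginning with [d]; applied to it, [bad_half] yields [c y' b = d c y'], and cancelling [c y']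
    leaves [a = d]. *)
Lemma bad_third a c d y : bad (a :: c :: d :: y) -> a = d.
Proof.
move=> bad_x; have [xn x1 xt] := bad_x.
have [a' [y1 [b [w [[<- yE] yw e1]]]]] := bad_half bad_x.
case: y1 yE yw e1 => [|c' y'] yE yw e1.
  by move: yw yE => /esym/size0nil -> [].
case: w yE yw => [//|e w] [? dE] [yw]; subst c'.
have := bad_half (bad_rot 1 bad_x); rewrite rot1_cons -cats1 dE cat_cons.
have -> : (y' ++ b :: e :: w) ++ [:: a] = rcons y' b ++ e :: rcons w a.
  by rewrite cat_rcons -catA /= cats1.
move=> [_ [y2 [b2 [w2 [[<- E2] yw2 e2]]]]].
have s2 : size y2 = size (rcons y' b).
  move: (congr1 size E2); rewrite !size_cat /= !size_rcons; lia.
have [? [? ?]] : rcons y' b = y2 /\ e :: rcons w a = b2 :: w2.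
  split; first by move/(congr1 (take (size y2))): E2; rewrite !take_size_cat.
  by move/(congr1 (drop (size y2))): E2; rewrite !drop_size_cat.
subst y2 b2 w2.
have [Z' Z'E] : exists Z', rcons y' b = d :: Z'.
  case: (y') dE => [|d' y''] [<- _]; first by exists [::].
  by exists (rcons y'' b).
have xE : a :: c :: d :: y = a :: (c :: rcons y' b) ++ e :: w.
  by rewrite /= cat_rcons dE.
(* This is [e2] with [y' b = d Z'] substituted and [d] moved across: [d c y' b = Z' e]. *)
pose x' := d :: (c :: rcons y' b) ++ rev (rcons Z' e).
have sZ : size Z' = size y'.
  by move: (congr1 size Z'E); rewrite size_rcons => -[].
have x'n : size x' = n.
  rewrite -xn xE /x' /= !size_cat size_rev !size_rcons /=; lia.
have x'1 : ev f x' = 1.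
  rewrite ev_cons ev_cat -e2 Z'E ev_rev // rcons_cons ev_cons.
  by rewrite -(mulgA (f d)) mulgV mulg1 f_inv.
(* If [x'] is a consequence of the relators, it rewrites [c y' b] in [x] as [d Z' e], which puts [e]
   next to another [e]; cancelling them leaves a relation of length [n - 2]. *)
have [x't|x't] := pselect (x' =w [::]).
  case: xt; rewrite xE.
  have cE : c :: rcons y' b =w d :: rcons Z' e.
    exact/(@eqw_move _ _ [:: d])/eqw_cons.
  have : a :: d :: Z' ++ w =w [::].
    apply: short_triv; first by rewrite -xn xE /= !size_cat /= size_rcons; lia.
    have dZ' : f d * ev f Z' = f c * ev f (rcons y' b) * f e.
      rewrite -(ev_cons f c) -e2 -(cats1 _ e) ev_cat ev_seq1 -mulgA f_inv mulg1.
      by rewrite Z'E ev_cons.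
    by rewrite -x1 xE /= !ev_cons !ev_cat ev_cons (mulgA (f d)) dZ' !mulgA.
  move=> sh; apply: pres_trans sh; apply: (@eqw_catl [:: a]).
  apply: pres_trans (eqw_catr _ cE) _.
  rewrite /= cat_rcons; apply: (@eqw_catl (d :: Z')).
  exact: (eqw_catr w (eqw_invol e)).
have [a2 [y3 [b3 [w3 [[? E3] yw3 e3]]]]] := bad_half (And3 x'n x'1 x't).
subst a2.
have s3 : size y3 = size (c :: y').
  move: (congr1 size E3); rewrite /= !size_cat size_rev /= !size_rcons; lia.
have [? ?] : c :: y' = y3 /\ b = b3.
  have {}E3 : (c :: y') ++ b :: rev (rcons Z' e) = y3 ++ b3 :: w3.
    by rewrite -E3 /= cat_rcons.
  split.
    by move/(congr1 (take (size y3))): E3; rewrite !take_size_cat.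
  by move/(congr1 (drop (size y3))): E3; rewrite !drop_size_cat // => -[].
subst y3 b3; apply/f_inj/(mulIg (ev f (c :: y'))).
by rewrite -!ev_cons -e3 -e1.
Qed.

Lemma nth_alternating (x0 : X) q x : size x = q.*2 ->
  (forall i, (i.+2 < size x)%N -> nth x0 x i = nth x0 x i.+2) ->
  x = flatten (nseq q [:: nth x0 x 0; nth x0 x 1]).
Proof.
elim: q x => [|q IH] [|a [|c x]] //= [] xq xE; do 2!congr (_ :: _).
have {}IH := IH x xq (fun i ix => xE i.+2 ix).
case: x xq xE IH => [|a' [|c' x]] /= xq xE; first by case: (q) xq.
  by case: (q) xq.
have /= -> := xE 0%N isT; have /= -> := xE 1%N isT; exact.
Qed.

Lemma relation_triv : forall x, size x = n -> ev f x = 1 -> x =w [::].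
Proof.
move=> x xn x1; apply: contrapT => xt.
have [a [y [b [w [xE yw _]]]]] := bad_half (And3 xn x1 xt).
have x_alt : x = flatten (nseq (size y).+1 [:: nth a x 0; nth a x 1]).
  apply: nth_alternating; first by rewrite xE /= size_cat /= yw; lia.
  move=> i ix; have := bad_rot i (And3 xn x1 xt).
  rewrite /rot (drop_nth a) ?(drop_nth a (n := i.+1)) ?(drop_nth a (n := i.+2));
    try lia.
  exact: bad_third.
apply: xt; rewrite x_alt; apply: eqw_alternating.
by rewrite -ev_alternating -x_alt.
Qed.

End MinimalRelation.

Lemma deletion_presents (W : set G) :
  [set ev f x | x in [set: seq X]] = W ->
  presents (coxeter_relators order_matrix) f W.
Proof.
move=> WE; split.
  rewrite -WE; apply/seteqP; split=> _ [x _ <-].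
    by exists (map fst x) => //; rewrite -eval_wordE.
  by exists (letters x) => //; rewrite eval_wordE // -map_comp map_id.
have triv n : forall x, (size x < n)%N -> ev f x = 1 -> x =w [::].
  elim: n => [//|n IH] x; rewrite ltnS => xn.
  apply: (@relation_triv (size x)) => // y yx; apply: IH.
  exact: leq_trans xn.
(* The relator [s s] identifies a formal inverse with its generator, so signed words reduce to
   unsigned ones. *)
have letterE p : pres_eq rel [:: p] [:: (p.1, true)].
  case: p => s [] /=; first exact: pres_refl.
  apply: (@pres_trans _ _ _ ([:: (s, true); (s, true)] ++ [:: (s, false)])).
    rewrite -{1}[[:: (s, false)]]cat0s; apply: pres_cat; last exact: pres_refl.
    exact/pres_sym/(eqw_invol s).
  rewrite -[X in pres_eq _ _ X]cats0.
  apply: (@pres_cat _ _ [:: (s, true)] [:: (s, true)]); first exact: pres_refl.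
  exact: (pres_cancel _ s true).
have wordE w : pres_eq rel w (letters (map fst w)).
  elim: w => [|p w IH]; first exact: pres_refl.
  exact: (@pres_cat _ _ [:: p] [:: (p.1, true)] _ _ (letterE p) IH).
move=> u v; rewrite !eval_wordE //; split=> [uv|].
  apply: pres_trans (wordE u) _; apply: pres_trans (pres_sym (wordE v)).
  apply/(@eqw_move _ _ [::])/(triv _ _ (ltnSn _)).
  by rewrite ev_cat ev_rev // uv mulgV.
elim=> {u v} //.
- by move=> u v w _ -> _ ->.
- by move=> u u' v v' _ eu _ ev; rewrite !map_cat !ev_cat eu ev.
- by move=> s b; rewrite /= !ev_cons !ev_nil mulg1 f_inv.
- move=> _ [s [t [k [/order_matrix_Some[_ stk _] ->]]]].
  by rewrite flatten_nseq2 ev_alternating stk ev_nil.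
Qed.


End DeletionCondition.

(** * Root strings and reflections *)

Section RootStrings.
Variables (K : realType) (V : vectType K) (B : {symmetric V}).
Hypothesis B_psd : positive_semidefinite B.

Lemma sformC u v : B u v = B v u.
Proof. by rewrite hermC expr0 mul1r. Qed.

Lemma sformDl u v w : B (u + v) w = B u w + B v w.
Proof. exact: linearDl. Qed.

Lemma sformDr u v w : B w (u + v) = B w u + B w v.
Proof. exact: linearDr. Qed.

Lemma sformZl c v w : B (c *: v) w = c * B v w.
Proof. exact: linearZl_LR. Qed.

Lemma sformZr c v w : B w (c *: v) = c * B w v.
Proof. exact: linearZr_LR. Qed.

Lemma sformNl v w : B (- v) w = - B v w.
Proof. exact: linearNl. Qed.

Lemma sformNr v w : B w (- v) = - B w v.
Proof. exact: linearNr. Qed.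

Lemma sform0l w : B 0 w = 0. Proof. exact: linear0l. Qed.

Lemma isotropic_orth s v : isotropic B s -> B s v = 0.
Proof.
by move=> /(mem_isotropic_space B_psd)/mem_orthovP/(_ v (memvf v)).
Qed.

Lemma isotropic_sform0 s v : s \in isotropic_space B -> B s v = 0.
Proof. by move=> /(mem_isotropic_space B_psd)/isotropic_orth. Qed.

Lemma sform_gt0 R v : anisotropic_roots B R v -> 0 < B v v.
Proof.
by move=> [_ v0]; rewrite lt_neqAle B_psd andbT eq_sym; apply/eqP; exact: v0.
Qed.

Lemma sform_cauchy_schwarz u v : B u v ^+ 2 <= B u u * B v v.
Proof.
have [u0|u0] := eqVneq (B u u) 0.
  by rewrite u0 isotropic_orth // mul0r expr0n.
have u_gt0 : 0 < B u u by rewrite lt_neqAle eq_sym u0 B_psd.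
have := B_psd (B u u *: v - B u v *: u).
rewrite sformDl !sformDr !sformNl !sformNr !sformZl !sformZr (sformC v u).
set A := B u u; set C := B u v; set D := B v v => h.
have {h} : 0 <= A * (A * D - C ^+ 2) by apply: le_trans h _; lra.
by rewrite pmulr_rge0 // subr_ge0.
Qed.

Definition root_refl (a v : V) : V := v - (2%:R * (B v a / B a a)) *: a.

Lemma root_refl_sform a u v : B (root_refl a u) (root_refl a v) = B u v.
Proof.
rewrite /root_refl sformDl !sformDr !sformNl !sformNr !sformZl !sformZr.
rewrite (sformC a v).
have [->|a0] := eqVneq (B a a) 0.
  by rewrite invr0 !mulr0 !mul0r !oppr0 !addr0.
by field.
Qed.

Variable R : set V.
Hypothesis R_ears : is_EARS B R.
Local Notation Rx := (anisotropic_roots B R).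

Lemma root_opp v : R v -> R (- v).
Proof. by move=> Rv; rewrite -(ears_opp R_ears); exists v. Qed.

Lemma aniso_opp v : Rx v -> Rx (- v).
Proof.
move=> [Rv v0]; split; first exact: root_opp.
move=> v0'; apply: v0; move: v0'.
by rewrite /isotropic /= sformNl sformNr opprK.
Qed.

Lemma aniso_neq0 v : Rx v -> v != 0.
Proof.
by move=> [_ v0]; apply: contra_notN v0 => /eqP ->; exact: sform0l.
Qed.

Lemma root_string a b : Rx a -> R b -> exists d u : nat,
  (forall n : int, - d%:Z <= n <= u%:Z -> R (b + a *~ n)) /\
  2%:R * (B b a / B a a) = (d%:Z - u%:Z)%:~R.
Proof.
move=> Ra Rb; have [d [u [strE duE]]] := ears_string R_ears Ra Rb.
exists d, u; split.
  move=> n nP.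
  have : [set b + a *~ n | n in [set n : int | - d%:Z <= n <= u%:Z]]
      (b + a *~ n) by exists n.
  by rewrite -strE => -[].
by rewrite (sformC b) -duE rmorphB /= !pmulrn.
Qed.

Lemma cartan_int a b : Rx a -> R b ->
  exists c : int, 2%:R * (B b a / B a a) = c%:~R.
Proof.
by move=> Ra Rb; have [d [u [_ ->]]] := root_string Ra Rb; exists (d%:Z - u%:Z).
Qed.

Lemma root_reflP a b : Rx a -> R b -> R (root_refl a b).
Proof.
move=> Ra Rb; have [d [u [strP duE]]] := root_string Ra Rb.
rewrite /root_refl duE -scaleNr -mulrNz scaler_int; apply: strP.
by rewrite opprB; apply/andP; split; lia.
Qed.

Lemma aniso_reflP a b : Rx a -> Rx b -> Rx (root_refl a b).
Proof.
move=> Ra [Rb b0]; split; first exact: root_reflP.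
by rewrite /isotropic /= root_refl_sform.
Qed.

Lemma root_sub_mul a b k : Rx a -> R b -> k%:R <= 2%:R * (B b a / B a a) ->
  R (b - a *+ k).
Proof.
move=> Ra Rb; have [d [u [strP ->]]] := root_string Ra Rb.
rewrite -[k%:R]/((Posz k)%:~R) ler_int => kdu.
have := strP (- k%:Z); rewrite mulrNz; apply.
by apply/andP; split; lia.
Qed.

Lemma root_sub a b : Rx a -> R b -> 0 < B b a -> R (b - a).
Proof.
move=> Ra Rb ba; rewrite -[a]mulr1n; apply: root_sub_mul => //.
have : 0 < 2%:R * (B b a / B a a).
  by rewrite mulr_gt0 // divr_gt0 // (sform_gt0 Ra).
have [c ->] := cartan_int Ra Rb; rewrite ltr0z => c0.
by rewrite -[1%:R]/((Posz 1)%:~R) ler_int.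
Qed.

(** The Cartan integer of [b] with respect to [g] is [2 / k.+1], so [k.+1] is 1 or 2, and (R4)
    excludes 2. *)
Lemma aniso_multiple b g k : Rx b -> Rx g -> g = b *+ k.+1 -> k = 0%N.
Proof.
move=> Rb Rg gE; have B0 := sform_gt0 Rb.
have k0 : (k.+1%:R : K) != 0 by rewrite pnatr_eq0.
have [c cE] := cartan_int Rg Rb.1.
have {cE} : (Posz 2)%:~R = c%:~R * (Posz k.+1)%:~R :> K.
  change (2%:R = c%:~R * k.+1%:R :> K).
  rewrite -cE gE -(scaler_nat _ b) !(sformZr, sformZl); field.
  by rewrite -natr1 addrC in k0; rewrite k0 andbT gt_eqF.
rewrite -intrM => /intr_inj ck.
have : (k.+1 %| 2)%N.
  by apply/dvdnP; exists `|c|%N; rewrite -[2%N]/`|2%:Z|%N ck abszM.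
move=> /(@dvdn_leq k.+1 2 isT); case: k {k0 ck} gE => [|[|k]] // gE _.
by case: (ears_reduced R_ears Rb); rewrite -gE; case: Rg.
Qed.

End RootStrings.

(** * Simple roots for a height functional *)

Section SimpleRoots.
Variables (K : realType) (V : vectType K) (B : {symmetric V}).
Hypothesis B_psd : positive_semidefinite B.
Variable R : set V.
Hypothesis R_ears : is_EARS B R.
Local Notation Rx := (anisotropic_roots B R).
Variable f : {scalar V}.
Hypothesis f_ge1 : forall v, R v -> v != 0 -> 1 <= `|f v|.

Definition pos_root v := R v /\ 0 < f v.

Definition indecomposable b :=
  pos_root b /\ ~ exists u v, [/\ pos_root u, pos_root v & b = u + v].

Definition simple_root b := Rx b /\ indecomposable b.

Lemma pos_root_ge1 v : pos_root v -> 1 <= f v.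
Proof.
move=> [Rv v0]; have := f_ge1 Rv; rewrite gtr0_norm //; apply.
by apply: contraTneq v0 => ->; rewrite raddf0 ltxx.
Qed.

Lemma root_f_eq0 v : R v -> f v = 0 -> v = 0.
Proof.
move=> Rv fv; apply/eqP; apply: contrapT => /negP /(f_ge1 Rv).
by rewrite fv normr0 ler10.
Qed.

Lemma aniso_f_sign v : Rx v -> ~ 0 < f v -> f v < 0.
Proof.
move=> Rv /negP; rewrite -leNgt le_eqVlt => /orP[/eqP fv|//].
by have := aniso_neq0 Rv; rewrite (root_f_eq0 Rv.1 fv) eqxx.
Qed.

(** Along [g, g - b, g - 2b, ...] the value of [f] stops being positive at some root. If it vanishes
    there, [g] is a multiple of [b]; if it is negative, the two roots around the sign change split
    [b] into positive roots. *)
Lemma simple_refl_pos b g : simple_root b -> Rx g -> 0 < f g ->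
  f (root_refl B b g) < 0 -> g = b.
Proof.
move=> [Rb [[Rb' fb] b_indec]] Rg fg.
have [c cE] := cartan_int R_ears Rb Rg.1.
rewrite /root_refl linearB linearZ cE /= => fr.
have c0 : 0 < c.
  rewrite -(ltr0z K) ltNge; apply/negP => c0; move: fr; rewrite ltNge.
  by rewrite subr_ge0 (le_trans _ (ltW fg)) // mulr_le0_ge0 // ltW.
have [n cn] : exists n, c = Posz n by case: (c) c0 => // n _; exists n.
subst c; have Rk k : (k <= n)%N -> R (g - b *+ k).
  by move=> kn; apply: (root_sub_mul R_ears Rb Rg.1); rewrite cE ler_nat.
have exk : exists k, f (g - b *+ k) <= 0.
  by exists n; rewrite linearB linearMn /= -mulr_natl ltW.
case: (ex_minnP exk) => k fk kmin.
have kn : (k <= n)%N by apply: kmin; rewrite linearB linearMn /= -mulr_natl ltW.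
case: k fk kmin kn => [|k] fk kmin kn.
  by move: fk; rewrite mulr0n subr0 leNgt fg.
have fk' : 0 < f (g - b *+ k).
  by rewrite ltNge; apply/negP => /kmin; rewrite ltnn.
move: fk; rewrite le_eqVlt => /orP[/eqP/(root_f_eq0 (Rk _ kn))/subr0_eq gE|fk].
  by move: (gE); rewrite (aniso_multiple B_psd R_ears Rb Rg gE).
case: b_indec; exists (g - b *+ k), (b *+ k.+1 - g); split.
- by split=> //; exact/Rk/ltnW.
- rewrite -opprB; split; first exact/(root_opp R_ears)/Rk.
  by rewrite linearN oppr_gt0.
- by rewrite addrC addrA subrK mulrS addrK.
Qed.

Lemma pos_root_sum n v : pos_root v -> f v < n%:R ->
  exists2 s : seq V, (forall x, x \in s -> indecomposable x)
    & v = \sum_(x <- s) x.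
Proof.
elim: n v => [|n IH] v v_pos vn.
  by have := v_pos.2; rewrite ltNge (ltW vn).
have [v_indec|] := pselect (indecomposable v).
  by exists [:: v]; rewrite ?big_seq1 // => x; rewrite inE => /eqP ->.
move=> /not_andP[//|/contrapT[x [y [x_pos y_pos vE]]]].
have x1 := pos_root_ge1 x_pos; have y1 := pos_root_ge1 y_pos.
move: vn; rewrite vE linearD /= -natr1 => vn.
have [||s sI xE] := IH x => //; first by lra.
have [||t tI yE] := IH y => //; first by lra.
exists (s ++ t); last by rewrite big_cat /= -xE -yE.
by move=> z; rewrite mem_cat => /orP[/sI|/tI].
Qed.

(** As [(a, a) > 0], some indecomposable summand [b] of [a] has [(a, b) > 0]. Such a [b] is
    anisotropic, hence simple, and for [a != b] its reflection keeps [a] positive while lowering [f]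
    by at least 1. *)
Lemma simple_root_ind (P : V -> Prop) :
  (forall b, simple_root b -> P b) ->
  (forall b a, simple_root b -> P (root_refl B b a) -> P a) ->
  forall a, Rx a -> 0 < f a -> P a.
Proof.
move=> P_simple P_refl.
suff Pn n : forall a, Rx a -> 0 < f a -> f a < n%:R -> P a.
  move=> a Ra fa; apply: (Pn (Num.truncn (f a)).+1) => //.
  by rewrite truncnS_gt.
elim: n => [|n IH] a Ra fa an; first by move: an; rewrite ltNge (ltW fa).
have [b [b_indec ab]] : exists b, indecomposable b /\ 0 < B a b.
  have [s sI aE] := pos_root_sum (conj Ra.1 fa) an.
  apply: contrapT => nb; have := sform_gt0 B_psd Ra.
  rewrite {2}aE linear_sumr ltNge => /negP; apply.
  rewrite big_seq; apply: sumr_le0 => x xs; rewrite leNgt; apply/negP => ax.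
  by apply: nb; exists x; split => //; exact: sI.
have Rb : Rx b.
  split; first by case: b_indec => -[].
  by move=> b0; move: ab; rewrite (sformC B) (isotropic_orth B_psd _ b0) ltxx.
have b_simple : simple_root b by [].
have [->|nab] := eqVneq a b; first exact: P_simple.
apply: (P_refl b) => //.
have fr : 0 < f (root_refl B b a).
  apply: contrapT => /(aniso_f_sign (aniso_reflP R_ears Rb Ra)).
  by move=> /(simple_refl_pos b_simple Ra fa)/eqP; exact/negP.
apply: IH => //; first exact: aniso_reflP.
have [c cE] := cartan_int R_ears Rb Ra.1.
have c0 : 0 < c%:~R :> K.
  by rewrite -cE mulr_gt0 // divr_gt0 // (sform_gt0 B_psd Rb).
have c1 : 1 <= c%:~R :> K.
  by move: c0; rewrite ltr0z => c0; rewrite -[1]/((Posz 1)%:~R) ler_int.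
move: an; rewrite /root_refl linearB linearZ cE /= -natr1.
have fb : 1 <= f b by apply: pos_root_ge1; case: b_indec.
have : 1 <= c%:~R * f b by rewrite mulr_ege1.
lra.
Qed.

End SimpleRoots.

(** * Reflections of the hyperbolic extension *)

Section HyperbolicReflections.
Variables (K : realType) (V : vectType K) (B : {symmetric V}).
Hypothesis B_psd : positive_semidefinite B.
Variable Vdot : {vspace V}.
Local Notation V0 := (isotropic_space B).
Local Notation H := (hyperbolic B Vdot).
Local Notation r := (@reflection K V B Vdot).
Local Notation form := (@hform K V B Vdot).
Local Notation incl := (@hincl K V B Vdot).

Lemma aut_ext (E : vectType K) (g h : aut_of E) :
  (forall v, aut_val g v = aut_val h v) -> g = h.
Proof. by move=> gh; apply: val_inj; apply/lfunP. Qed.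

Lemma autM (E : vectType K) (g h : aut_of E) v :
  aut_val (g * h)%g v = aut_val g (aut_val h v).
Proof. exact: comp_lfunE. Qed.

Lemma aut1 (E : vectType K) (v : E) : aut_val (1%g : aut_of E) v = v.
Proof. exact: id_lfunE. Qed.

Lemma autKV (E : vectType K) (g : aut_of E) v :
  aut_val g (aut_val g^-1%g v) = v.
Proof. by rewrite -autM mulgV aut1. Qed.

Lemma autVK (E : vectType K) (g : aut_of E) v :
  aut_val g^-1%g (aut_val g v) = v.
Proof. by rewrite -autM mulVg aut1. Qed.

Lemma reflectionE (a v : H) :
  aut_val (r a) v = v - (2%:R * (form v a / form a a)) *: a.
Proof. by rewrite /= lfunE. Qed.

Lemma reflection_invol (a : H) : (r a * r a = 1)%g.
Proof.
apply: aut_ext => v; rewrite autM aut1 /= !lfunE.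
exact: reflection_involutive.
Qed.

Lemma hformC (u v : H) : form u v = form v u.
Proof. by rewrite /hform sformC [RHS]addrC [X in _ = _ + X]addrC addrA. Qed.

Lemma hformDl (u v w : H) : form (u + v) w = form u w + form v w.
Proof. by rewrite -[u]scale1r hform_linear mul1r scale1r. Qed.

Lemma hformZl c (v w : H) : form (c *: v) w = c * form v w.
Proof.
have h0 : form 0 w = 0.
  by apply: (addrI (form 0 w)); rewrite -hformDl !addr0.
by rewrite -[c *: v]addr0 hform_linear h0 addr0.
Qed.

Lemma hformNl (v w : H) : form (- v) w = - form v w.
Proof. by rewrite -scaleN1r hformZl mulN1r. Qed.

Lemma hformDr (u v w : H) : form w (u + v) = form w u + form w v.
Proof. by rewrite hformC hformDl !(hformC _ w). Qed.

Lemma hformZr c (v w : H) : form w (c *: v) = c * form w v.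
Proof. by rewrite hformC hformZl (hformC _ w). Qed.

Lemma hformNr (v w : H) : form w (- v) = - form w v.
Proof. by rewrite hformC hformNl (hformC _ w). Qed.

Definition isometry (g : aut_of H) :=
  forall u v, form (aut_val g u) (aut_val g v) = form u v.

Lemma isometryM g h : isometry g -> isometry h -> isometry (g * h)%g.
Proof. by move=> gI hI u v; rewrite !autM gI hI. Qed.

Lemma isometry1 : isometry 1%g.
Proof. by move=> u v; rewrite !aut1. Qed.

Lemma isometry_reflection a : isometry (r a).
Proof.
move=> u v; rewrite !reflectionE hformDl !hformDr !hformNl !hformNr !hformZl.
rewrite !hformZr (hformC a v).
have [->|a0] := eqVneq (form a a) 0.
  by rewrite invr0 !mulr0 !mul0r !oppr0 !addr0.
by field.
Qed.

Lemma isometry_conj (g : aut_of H) a : isometry g ->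
  (r (aut_val g a) = g * r a * g^-1)%g.
Proof.
move=> gI; apply: (mulIg g); rewrite mulgVK; apply: aut_ext => v.
by rewrite !autM !reflectionE !gI [RHS]linearB [X in _ = _ - X]linearZ.
Qed.

Lemma reflectionN a : r (- a) = r a.
Proof.
apply: aut_ext => v; rewrite !reflectionE !hformNr !hformNl opprK.
by rewrite mulNr mulrN scalerN scaleNr opprK.
Qed.

Hypothesis V_disj : (V0 :&: Vdot = 0)%VS.
Hypothesis V_full : (V0 + Vdot)%VS = fullv.

Lemma hincl_is_linear : linear incl.
Proof.
move=> c u v; apply: injective_projections; last by rewrite /= scaler0 addr0.
by apply: injective_projections; rewrite /= !linearP.
Qed.
HB.instance Definition _ :=
  GRing.isLinear.Build K V H *:%R incl hincl_is_linear.

Lemma decompP v : v = daddv_pi V0 Vdot v + daddv_pi Vdot V0 v.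
Proof. by rewrite daddv_pi_add // V_full memvf. Qed.

Lemma hform_hincl u v : form (incl u) (incl v) = B u v.
Proof.
rewrite /hform /= lfunE /= add0r vsprojK ?memv_pi // vsprojK ?memv_pi //.
rewrite lfunE /= addr0 {2}(decompP u) {2}(decompP v) sformDl !sformDr.
have iso w x : B (daddv_pi V0 Vdot w) x = 0.
  by apply: isotropic_sform0 => //; exact: memv_pi.
by rewrite !iso (sformC _ _ (daddv_pi V0 Vdot v)) iso !add0r.
Qed.

Lemma hincl_inj : injective incl.
Proof.
move=> u v [/(congr1 vsval) e1 /(congr1 vsval) e2]; move: e1 e2.
rewrite !vsprojK ?memv_pi // => e1 e2.
by rewrite (decompP u) (decompP v) e1 e2.
Qed.

Lemma reflection_hincl a v :
  aut_val (r (incl a)) (incl v) = incl (root_refl B a v).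
Proof.
by rewrite reflectionE !hform_hincl [RHS]linearB [X in _ = _ - X]linearZ.
Qed.

Lemma reflection_root_refl a b :
  (r (incl (root_refl B a b)) = r (incl a) * r (incl b) * r (incl a))%g.
Proof.
rewrite -reflection_hincl isometry_conj; last exact: isometry_reflection.
by rewrite (mulg1_eq (reflection_invol _)).
Qed.

End HyperbolicReflections.

(** * The Coxeter presentation attached to a height functional *)

Section HeightPresentation.
Variables (K : realType) (V : vectType K) (B : {symmetric V}).
Hypothesis B_psd : positive_semidefinite B.
Variable R : set V.
Hypothesis R_ears : is_EARS B R.
Local Notation Rx := (anisotropic_roots B R).
Variable f : {scalar V}.
Hypothesis f_ge1 : forall v, R v -> v != 0 -> 1 <= `|f v|.
Variable Vdot : {vspace V}.
Hypothesis V_disj : (isotropic_space B :&: Vdot = 0)%VS.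
Hypothesis V_full : (isotropic_space B + Vdot)%VS = fullv.
Local Notation r v := (@reflection K V B Vdot (@hincl K V B Vdot v)).

Section Words.
Variables (X : Type) (g : X -> V).
Hypothesis g_simple : forall s, simple_root B R f (g s).
Let F s := r (g s).

Let F_inv s : (F s * F s = 1)%g. Proof. exact: reflection_invol. Qed.

Let g_aniso s : Rx (g s). Proof. by case: (g_simple s). Qed.

Definition word_act (x : seq X) (v : V) :=
  foldr (fun s v => root_refl B (g s) v) v x.

Lemma word_act_cat x y v : word_act (x ++ y) v = word_act x (word_act y v).
Proof. exact: foldr_cat. Qed.

Lemma ev_hincl x v :
  aut_val (ev F x) (@hincl K V B Vdot v) = @hincl K V B Vdot (word_act x v).
Proof.
elim: x => [|s x IH]; first by rewrite ev_nil aut1.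
by rewrite ev_cons autM IH reflection_hincl.
Qed.

Lemma word_act_ev x y v : ev F x = ev F y -> word_act x v = word_act y v.
Proof.
by move=> xy; apply: (hincl_inj V_disj V_full); rewrite -!ev_hincl xy.
Qed.

Lemma word_act_revK x v : word_act (rev x) (word_act x v) = v.
Proof.
rewrite -word_act_cat (@word_act_ev _ [::]) //.
by rewrite ev_cat (ev_rev F_inv) mulVg ev_nil.
Qed.

Lemma word_actVK x v : word_act x (word_act (rev x) v) = v.
Proof. by rewrite -{1}(revK x) word_act_revK. Qed.

Lemma root_reflN a v : root_refl B a (- v) = - root_refl B a v.
Proof. by rewrite /root_refl sformNl mulNr mulrN scaleNr -opprD. Qed.

Lemma word_actN x v : word_act x (- v) = - word_act x v.
Proof. by elim: x => //= s x ->; exact: root_reflN. Qed.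

Lemma word_act_aniso x v : Rx v -> Rx (word_act x v).
Proof. by move=> Rv; elim: x => //= s x IH; exact: aniso_reflP. Qed.

Lemma reflection_word_act x v :
  r (word_act x v) = (ev F x * r v * (ev F x)^-1)%g.
Proof.
rewrite -ev_hincl isometry_conj //.
elim: x => [|s x IH]; first by rewrite ev_nil; exact: isometry1.
by rewrite ev_cons; apply: isometryM IH; exact: isometry_reflection.
Qed.

Fixpoint inversion_roots (x : seq X) : seq V :=
  if x is s :: x' then
    g s :: [seq root_refl B (g s) v | v <- inversion_roots x']
  else [::].

Lemma inversion_roots_rcons x b :
  inversion_roots (rcons x b) = rcons (inversion_roots x) (word_act x (g b)).
Proof. by elim: x => //= s x ->; rewrite map_rcons. Qed.

Lemma size_inversion_roots x : size (inversion_roots x) = size x.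
Proof. by elim: x => //= s x IH; rewrite size_map IH. Qed.

Lemma root_reflK s v : root_refl B (g s) (root_refl B (g s) v) = v.
Proof. exact: (word_act_revK [:: s]). Qed.

Lemma root_refl_simple s : root_refl B (g s) (g s) = - g s.
Proof.
rewrite /root_refl divff ?gt_eqF ?(sform_gt0 B_psd (g_aniso s)) // mulr1.
by rewrite scaler_nat mulr2n opprD addrA subrr add0r.
Qed.

Lemma mem_inversion_roots x v : Rx v -> 0 < f v ->
  f (word_act (rev x) v) < 0 -> v \in inversion_roots x.
Proof.
elim: x v => [|s x IH] v Rv fv /=; first by rewrite ltNge (ltW fv).
rewrite rev_cons -cats1 word_act_cat /= inE => fx.
have [rv|rv] := pselect (0 < f (root_refl B (g s) v)).
  rewrite -[v](root_reflK s) map_f ?orbT //; apply: IH => //.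
  exact: aniso_reflP.
have := aniso_f_sign f_ge1 (aniso_reflP R_ears (g_aniso s) Rv) rv.
move=> /(simple_refl_pos B_psd R_ears f_ge1 (g_simple s) Rv fv) ->.
by rewrite eqxx.
Qed.

(** Applying the letters of [x] from the right, the root [g b] first turns negative at some letter
    [a]. There it must equal [g a], so [F a] is the conjugate of [F b] by the letters already
    applied. *)
Lemma word_exchange x b : f (word_act x (g b)) < 0 ->
  exists x1 a x2, x = x1 ++ a :: x2 /\ ev F (rcons x2 b) = ev F (a :: x2).
Proof.
elim: x => [|a x IH] /= fx.
  by have [_ [[_ /ltW]]] := g_simple b; rewrite leNgt fx.
have [xb|xb] := pselect (0 < f (word_act x (g b))); last first.
  have := aniso_f_sign f_ge1 (word_act_aniso x (g_aniso b)) xb.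
  move=> /IH[x1 [a' [x2 [-> xa]]]].
  by exists (a :: x1), a', x2.
exists [::], a, x; split => //; rewrite -cats1 ev_cat ev_seq1 ev_cons.
have Ra := simple_refl_pos B_psd R_ears f_ge1 (g_simple a)
  (word_act_aniso x (g_aniso b)) xb fx.
have -> : F a = r (word_act x (g b)) by rewrite Ra.
by rewrite reflection_word_act mulgVK.
Qed.

Let has_deletion (x : seq X) := exists x1 a x2 b x3,
  x = x1 ++ a :: x2 ++ b :: x3 /\ ev F (rcons x2 b) = ev F (a :: x2).

(** Appending [b] adds the root [word_act x (g b)]: it is positive, since otherwise [word_exchange]
    gives a deletion, and new, since the inverse of [x] sends it back to the positive root [g b]. *)
Lemma inversion_roots_uniq x : ~ has_deletion x ->
  uniq (inversion_roots x) /\ forall v, v \in inversion_roots x ->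
    [/\ Rx v, 0 < f v & f (word_act (rev x) v) < 0].
Proof.
elim/last_ind: x => [//|x b IH] nx.
have {}IH : uniq (inversion_roots x) /\ forall v, v \in inversion_roots x ->
    [/\ Rx v, 0 < f v & f (word_act (rev x) v) < 0].
  apply: IH => -[x1 [a [x2 [c [x3 [xE ac]]]]]]; apply: nx.
  exists x1, a, x2, c, (rcons x3 b); split => //.
  by rewrite xE rcons_cat /= rcons_cat.
have [_ [[_ fb] _]] := g_simple b.
have Rxb := word_act_aniso x (g_aniso b).
have xb : 0 < f (word_act x (g b)).
  apply: contrapT => /(aniso_f_sign f_ge1 Rxb) /word_exchange.
  move=> [x1 [a [x2 [xE ab]]]]; apply: nx; exists x1, a, x2, b, [::].
  by split => //; rewrite xE rcons_cat /= cats1.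
rewrite inversion_roots_rcons rcons_uniq IH.1 andbT; split.
  apply/negP => /IH.2[_ _]; rewrite word_act_revK ltNge.
  by rewrite ltW.
move=> v; rewrite mem_rcons inE rev_rcons /= => /orP[/eqP ->|/IH.2[Rv fv vx]].
  split => //; rewrite word_act_revK root_refl_simple linearN oppr_lt0.
  exact: fb.
(* An old inversion [v] undone by [b] would satisfy [x^-1 v = - g b], so that [x (g b) = - v] would
   be negative, against [xb]. *)
split => //; apply: contrapT => /negP; rewrite -leNgt => fr.
have Rn := aniso_opp R_ears (word_act_aniso (rev x) Rv).
have nf : 0 < f (- word_act (rev x) v) by rewrite linearN oppr_gt0.
have nr : f (root_refl B (g b) (- word_act (rev x) v)) < 0.
  apply: (aniso_f_sign f_ge1); first exact: aniso_reflP.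
  by rewrite root_reflN linearN oppr_gt0; apply/negP; rewrite -leNgt.
have := simple_refl_pos B_psd R_ears f_ge1 (g_simple b) Rn nf nr.
move=> vb; move: xb; rewrite -vb word_actN word_actVK linearN oppr_gt0.
by rewrite ltNge (ltW fv).
Qed.

(** The positive roots made negative by the inverse of the product depend on the group element
    alone. Without a deletion in [x] there would be at least [size x] of them, yet all occur in the
    list attached to [y]. *)
Lemma simple_deletion x y : ev F x = ev F y -> (size y < size x)%N ->
  has_deletion x.
Proof.
move=> xy yx; apply: contrapT => /inversion_roots_uniq[xU xinv].
suff : (size (inversion_roots x) <= size (inversion_roots y))%N.
  by rewrite !size_inversion_roots leqNgt yx.
apply: uniq_leq_size => // v /xinv[Rv fv xv].
apply: mem_inversion_roots => //; rewrite (@word_act_ev _ (rev x)) //.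
by rewrite !(ev_rev F_inv) xy.
Qed.

End Words.

Lemma height_coxeter_presentation : has_coxeter_presentation B Vdot R.
Proof.
pose S := [set r b | b in simple_root B R f].
exists S; split; first by move=> _ [b [Rb _] <-]; exists b.
(* The letters are the reflections themselves, each with a chosen simple root; this makes the letter
   map injective at once. *)
have exg (s : set_type S) : exists b, simple_root B R f b /\ r b = val s.
  by case: s => s /= /set_mem[b sb <-]; exists b.
have [g gP] := choice exg.
have g_simple s : simple_root B R f (g s) by case: (gP s).
have gE : (fun s => r (g s)) = (fun s : set_type S => val s).
  by apply/funext => s; case: (gP s).
have f_inv (s : set_type S) : (val s * val s = 1)%g.
  by case: (gP s) => _ <-; exact: reflection_invol.
have f_inj : injective (fun s : set_type S => val s).
  by move=> s t; exact: val_inj.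
exists (order_matrix (fun s : set_type S => val s)); split.
  exact: order_matrix_coxeter f_inv f_inj.
apply: deletion_presents => //.
  by move=> x y; rewrite -gE; exact: simple_deletion.
set E := [set _ | _ in _].
have Emul x y : E x -> E y -> E (x * y)%g.
  by move=> [u _ <-] [v _ <-]; exists (u ++ v) => //; rewrite ev_cat.
have Einv x : E x -> E x^-1%g.
  by move=> [u _ <-]; exists (rev u) => //; rewrite (ev_rev f_inv).
have ES b : simple_root B R f b -> E (r b).
  move=> sb; have Sb : S (r b) by exists b.
  by exists [:: SigSub (mem_set Sb)] => //; rewrite ev_seq1.
apply/seteqP; split.
  move=> _ [u _ <-] W [[W1 WM WV] SW].
  elim: u => [|s u IH]; first by rewrite ev_nil.
  rewrite ev_cons; apply: WM => //; apply: SW.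
  by case: (gP s) => -[Rs _] <-; exists (g s).
apply: smallest_sub; first by split => //; exists [::] => //; rewrite ev_nil.
have Epos a : Rx a -> 0 < f a -> E (r a).
  apply: (simple_root_ind B_psd R_ears f_ge1 (P := fun a => E (r a))) => //.
  move=> b v sb; rewrite reflection_root_refl // => Ev.
  have := Emul _ _ (Emul _ _ (ES _ sb) Ev) (ES _ sb).
  rewrite -!mulgA reflection_invol mulg1 !mulgA reflection_invol mul1g //.
move=> _ [a Ra <-]; have [fa|fa] := pselect (0 < f a); first exact: Epos.
have := aniso_f_sign f_ge1 Ra fa => fa'.
have <- : r (- a) = r a by rewrite linearN reflectionN.
by apply: Epos; [exact: aniso_opp | rewrite linearN oppr_gt0].
Qed.

End HeightPresentation.

(** * Fundamental lifts and height functionals *)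

HB.instance Definition _ (K : fieldType) (V : vectType K) (U : {vspace V}) :=
  GRing.isLinear.Build K V (quotv U) *:%R (to_quotv U) (@to_quotv_linear K V U).

Section FundamentalLift.
Variables (K : realType) (V : vectType K) (B : {symmetric V}).
Hypothesis B_psd : positive_semidefinite B.
Variable R : set V.
Hypothesis R_ears : is_EARS B R.
Variables (l : nat) (a : l.-tuple V).
Hypothesis a_lift : fundamental_lift B R a.
Local Notation Rx := (anisotropic_roots B R).
Local Notation V0 := (isotropic_space B).
Local Notation pi := (to_quotv V0).

Lemma to_quotv0 v : v \in V0 -> pi v = 0.
Proof. by move=> ?; apply/to_quotv_eq0. Qed.

Lemma mem_sub_quotv u v : pi u = pi v -> u - v \in V0.
Proof. by move=> uv; apply/to_quotv_eq0; rewrite linearB /= uv subrr. Qed.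

Definition quotv_basis : l.-tuple (quotv V0) := [tuple of [seq pi v | v <- a]].

Lemma quotv_basisP : basis_of fullv quotv_basis.
Proof. by case: a_lift => _ []. Qed.

Lemma nth_quotv_basis (i : 'I_l) : quotv_basis`_i = pi (tnth a i).
Proof. by rewrite /= (nth_map 0) ?size_tuple // (tnth_nth 0). Qed.

Lemma nullspace_disj : (V0 :&: <<a>> = 0)%VS.
Proof.
apply/eqP; rewrite -subv0; apply/subvP => v; rewrite memv_cap => /andP[vV0 va].
have vE := coord_span va; have := to_quotv0 vV0.
rewrite {1}vE linear_sum /= => v0.
have /freeP/(_ (coord a ^~ v)) k0 := basis_free quotv_basisP.
rewrite memv0 vE big1 // => i _; rewrite k0 ?scale0r //.
rewrite -[RHS]v0; apply: eq_bigr => j _.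
by rewrite nth_quotv_basis linearZ /= (tnth_nth 0).
Qed.

Lemma nullspace_full : (V0 + <<a>>)%VS = fullv.
Proof.
apply/eqP; rewrite eqEsubv subvf /=; apply/subvP => v _.
pose w := \sum_(i < l) coord quotv_basis i (pi v) *: tnth a i.
have vw : v - w \in V0.
  apply: mem_sub_quotv; rewrite linear_sum.
  rewrite {1}(coord_basis quotv_basisP (memvf (pi v))).
  by apply: eq_bigr => i _; rewrite nth_quotv_basis linearZ.
rewrite -[v](subrK w); apply: memv_add => //; apply: memv_suml => i _.
by apply/memvZ/memv_span/mem_tnth.
Qed.

Lemma root_coords v : Rx v -> exists c : 'I_l -> nat,
  v - \sum_i tnth a i *+ c i \in V0 \/ - v - \sum_i tnth a i *+ c i \in V0.
Proof.
move=> Rv; have [_ [_ _ /(_ (pi v))]] := a_lift.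
have -> : size [seq pi v | v <- a] = l by rewrite size_map size_tuple.
case; first by exists v.
move=> c cE; exists c.
have piE : pi (\sum_i tnth a i *+ c i) =
    \sum_(i < l) [seq pi v | v <- a]`_i *+ c i.
  rewrite linear_sum; apply: eq_bigr => i _.
  by rewrite linearMn (nth_map 0) ?size_tuple // (tnth_nth 0).
case: cE => cE; [left|right]; apply: mem_sub_quotv; rewrite piE //.
by rewrite linearN /= cE opprK.
Qed.

Definition simple_height v : K := \sum_i coord quotv_basis i (pi v).

Lemma simple_height_scalar : scalar simple_height.
Proof.
move=> c u v; rewrite /simple_height mulr_sumr -big_split.
by apply: eq_bigr => i _; rewrite !linearP.
Qed.
HB.instance Definition _ :=
  GRing.isLinear.Build K V K *%R simple_height simple_height_scalar.

Lemma simple_height_null v : v \in V0 -> simple_height v = 0.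
Proof.
by move=> v0; rewrite /simple_height big1 // => i _; rewrite to_quotv0 ?linear0.
Qed.

Lemma simple_height1 (i : 'I_l) : simple_height (tnth a i) = 1.
Proof.
rewrite /simple_height (bigD1 i) //= -nth_quotv_basis.
rewrite coord_free ?(basis_free quotv_basisP) // eqxx big1 ?addr0 // => j ji.
by rewrite coord_free ?(basis_free quotv_basisP) // eq_sym (negbTE ji).
Qed.

Lemma simple_height_sum (c : 'I_l -> nat) :
  simple_height (\sum_i tnth a i *+ c i) = (\sum_i c i)%N%:R.
Proof.
rewrite linear_sum natr_sum; apply: eq_bigr => i _.
by rewrite linearMn /= simple_height1.
Qed.

Lemma simple_height_ge1 v : Rx v -> 1 <= `|simple_height v|.
Proof.
move=> Rv; suff [c [cN0 cE]] : exists c : 'I_l -> nat,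
    (\sum_i c i != 0)%N /\ `|simple_height v| = (\sum_i c i)%N%:R.
  by rewrite cE ler1n lt0n.
have nsum (c : 'I_l -> nat) u : Rx u ->
    u - \sum_i tnth a i *+ c i \in V0 -> (\sum_i c i != 0)%N.
  move=> [_ u0] uc; apply/eqP => /eqP; rewrite sum_nat_eq0 => /forallP c0.
  apply: u0; apply/(mem_isotropic_space B_psd); move: uc.
  by rewrite big1 ?subr0 // => i _; rewrite (eqP (c0 i)).
have [c [] cE] := root_coords Rv; exists c; split.
- exact: nsum cE.
- have /eqP := simple_height_null cE.
  rewrite linearB /= simple_height_sum subr_eq0 => /eqP ->.
  by rewrite normr_nat.
- exact: (nsum _ _ (aniso_opp R_ears Rv)).
- have /eqP := simple_height_null cE.
  rewrite linearB linearN /= simple_height_sum subr_eq0 => /eqP h.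
  by rewrite -normrN h normr_nat.
Qed.

(* Cartan integers lie in [-4, 4], so shifting them by 4 indexes the classes of
   R^x modulo V^0 by a finite type. *)
Definition cartan_class (k : {ffun 'I_l -> 'I_9}) (v : V) := forall i,
  2%:R * (B v (tnth a i) / B (tnth a i) (tnth a i)) = (k i)%:R - 4%:R.

(** By Cauchy-Schwarz the two Cartan integers of [u] and [v] have product in [[0, 4]], and they
    vanish together; a nonzero one is thus at most the product in absolute value. *)
Lemma cartan_bound u v : Rx u -> Rx v ->
  `|2%:R * (B v u / B u u)| <= 4%:R :> K.
Proof.
move=> Ru Rv; have u0 := sform_gt0 B_psd Ru; have v0 := sform_gt0 B_psd Rv.
have [c cE] := cartan_int R_ears Ru Rv.1.
have [d dE] := cartan_int R_ears Rv Ru.1.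
have cdE : c%:~R * d%:~R = 4%:R * (B v u ^+ 2 / (B u u * B v v)) :> K.
  by rewrite -cE -dE (sformC B u v); field; rewrite !gt_eqF.
have cd4 : c%:~R * d%:~R <= 4%:R :> K.
  rewrite cdE ler_piMr // ler_pdivrMr ?mulr_gt0 // mul1r mulrC.
  exact: sform_cauchy_schwarz.
have cd0 : 0 <= c%:~R * d%:~R :> K.
  by rewrite cdE mulr_ge0 // divr_ge0 ?sqr_ge0 // mulr_ge0 // ltW.
have d0 : d = 0 -> c = 0.
  move=> d0; move: dE; rewrite d0 sformC => /eqP.
  rewrite mulf_eq0 pnatr_eq0 /= mulf_eq0 invr_eq0 (gt_eqF v0) orbF => /eqP vu.
  by apply/eqP; rewrite -(intr_eq0 K) -cE vu mul0r mulr0.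
rewrite cE -intr_norm -[4%:R]/((Posz 4)%:~R) ler_int.
move: cd4 cd0; rewrite -intrM -[4%:R]/((Posz 4)%:~R) ler_int ler0z => cd4 cd0.
have [/d0 ->|d_neq0] := eqVneq d 0; first by [].
have : `|c| <= `|c| * `|d| by rewrite ler_peMr // -gtz0_ge1 normr_gt0.
by rewrite -normrM (ger0_norm cd0) => /le_trans; apply.
Qed.

Lemma cartan_classP v : Rx v -> exists k, cartan_class k v.
Proof.
move=> Rv; suff /choice[k kE] : forall i, exists n : 'I_9,
    2%:R * (B v (tnth a i) / B (tnth a i) (tnth a i)) = n%:R - 4%:R.
  by exists [ffun i => k i] => i; rewrite ffunE.
move=> i; have Ra : Rx (tnth a i) by case: a_lift.
have := cartan_bound Ra Rv; have [c ->] := cartan_int R_ears Ra Rv.1.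
rewrite -intr_norm -[4%:R]/((Posz 4)%:~R) ler_int => c4.
have n9 : (`|(c + 4)%R| < 9)%N by lia.
exists (Ordinal n9) => /=; rewrite -[X in X - _]/((Posz _)%:~R) -rmorphB /=.
by congr (_%:~R); lia.
Qed.

(** The difference is orthogonal to every [a_i] and to [V^0], hence to all of [V]. *)
Lemma cartan_class_sub k u v : cartan_class k u -> cartan_class k v ->
  u - v \in V0.
Proof.
move=> ku kv; have orth_a i : B (u - v) (tnth a i) = 0.
  have Ra : Rx (tnth a i) by case: a_lift.
  have := ku i; rewrite -(kv i) => /(mulfI _)-/(_ _).
  have a0 := sform_gt0 B_psd Ra.
  rewrite sformDl sformNl; move/(_ _)/(divIf _) => uv.
  by rewrite uv ?subrr // ?gt_eqF // pnatr_eq0.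
apply/mem_isotropic_space => //; rewrite /isotropic /=.
have : u - v \in (V0 + <<a>>)%VS by rewrite nullspace_full memvf.
move=> /memv_addP[x x0 [y ya uvE]]; rewrite {2}uvE sformDr.
rewrite sformC isotropic_sform0 // add0r (coord_span ya) linear_sumr /=.
by rewrite big1 // => i _; rewrite linearZr_LR /= -tnth_nth orth_a mulr0.
Qed.

End FundamentalLift.

(** * A height functional when the nullity is at most 1 *)

Section SmallNullity.
Variables (K : realType) (V : vectType K) (B : {symmetric V}).
Hypothesis B_psd : positive_semidefinite B.
Variable R : set V.
Hypothesis R_ears : is_EARS B R.
Variables (l : nat) (a : l.-tuple V).
Hypothesis a_lift : fundamental_lift B R a.
Local Notation Rx := (anisotropic_roots B R).
Local Notation V0 := (isotropic_space B).

Lemma root_line_gap d : exists2 e : K, 0 < e &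
  forall t, R (t *: d) -> t *: d != 0 -> e <= `|t|.
Proof.
have v2r0 : [set (v2r v : 'rV[K]_(dim V)) | v in R] 0.
  by exists 0; [exact: ears_0 R_ears | rewrite linear0].
have [_ [W /nbhs_ballP[e e0 We] WE]] := ears_discrete R_ears v2r0.
(* The summand 1 keeps the divisor positive when [d = 0], which is the case of nullity 0. *)
have M0 : 0 < 1 + `|v2r d : 'rV[K]_(dim V)| by rewrite ltr_pwDl.
exists (e / (1 + `|v2r d : 'rV[K]_(dim V)|)); first by rewrite divr_gt0.
move=> t Rt; apply: contraNT; rewrite -ltNge ltr_pdivlMr // => te.
apply/eqP; apply: v2r_inj; rewrite [RHS]linear0.
suff : (W `&` [set (v2r v : 'rV[K]_(dim V)) | v in R]) (v2r (t *: d)).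
  by rewrite WE.
split; last by exists (t *: d).
apply: We; rewrite -ball_normE /= sub0r normrN linearZ /= normrZ.
by apply: le_lt_trans te; rewrite ler_wpM2l // lerDr.
Qed.

Lemma subv_line (U : {vspace V}) : (\dim U < 2)%N ->
  exists d, U = <[d]>%VS.
Proof.
move=> U1; exists (vpick U).
have [->|U0] := eqVneq U 0%VS.
  by apply/esym/eqP; rewrite -subv0; apply/subvP => v /vlineP[k ->];
     rewrite memvZ // memv_pick.
apply/esym/eqP; rewrite eqEdim -memvE memv_pick dim_vline vpick0 U0 /=.
by rewrite -ltnS.
Qed.

Variable d : V.
Hypothesis V0_line : V0 = <[d]>%VS.

Definition null_coord (v : V) : K :=
  coord [tuple d] 0 (daddv_pi V0 <<a>>%VS v).

Lemma null_coord_scalar : scalar null_coord.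
Proof. by move=> c u v; rewrite /null_coord !linearP. Qed.
HB.instance Definition _ :=
  GRing.isLinear.Build K V K *%R null_coord null_coord_scalar.

Lemma null_coordE v : v \in V0 -> v = null_coord v *: d.
Proof.
move=> v0; rewrite /null_coord daddv_pi_id ?(nullspace_disj a_lift) //.
have vd : v \in <<[tuple d]>>%VS by rewrite span_seq1 -V0_line.
by rewrite {1}(coord_span vd) big_ord1.
Qed.

(** Two distinct roots of one class differ by a nonzero isotropic root, so their null coordinates
    are separated by the gap [e]. Since [simple_height] is constant on the class, a positive lower
    bound for the nonzero null coordinates suffices. *)
Lemma root_class_gap k : exists2 lam : K, 0 <= lam &
  forall v, Rx v -> cartan_class B a k v -> null_coord v != 0 ->
    `|simple_height B a v| + 1 <= lam * `|null_coord v|.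
Proof.
pose A v := [/\ Rx v, cartan_class B a k v & null_coord v != 0].
have [[v1 [R1 k1 x1]]|nA] := pselect (exists v, A v); last first.
  by exists 0 => // v Rv kv xv; case: nA; exists v.
have sub_null u v : A u -> A v -> u - v \in V0.
  by move=> [_ ku _] [_ kv _]; exact: (cartan_class_sub B_psd a_lift ku kv).
have [e e0 eP] := root_line_gap d.
have sep u v : A u -> A v -> u != v -> e <= `|null_coord u - null_coord v|.
  move=> Au Av uv; have uv0 := sub_null _ _ Au Av.
  have uvE := null_coordE uv0; rewrite -linearB /=; apply: eP; last first.
    by rewrite -uvE subr_eq0.
  rewrite -uvE; have [[Ru _ _] [Rv _ _]] := (Au, Av).
  apply: (root_sub B_psd R_ears Rv Ru.1).
  rewrite -[u](subrK v) sformDl (isotropic_sform0 B_psd _ uv0) add0r.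
  exact: (sform_gt0 B_psd Rv).
(* At most one root of the class has null coordinate below [e / 2] in absolute value; if it exists,
   it supplies the minimum. *)
have [m m0 mP] : exists2 m : K, 0 < m & forall v, A v -> m <= `|null_coord v|.
  have [[v0 [A0 x0]]|nA] :=
      pselect (exists v, A v /\ `|null_coord v| < e / 2%:R).
    exists `|null_coord v0|; first by case: A0 => _ _ ?; rewrite normr_gt0.
    move=> v Av; have [->//|/(sep _ _ Av A0)] := eqVneq v v0.
    have := ler_normB (null_coord v) (null_coord v0); move: x0.
    lra.
  exists (e / 2%:R); first by rewrite divr_gt0.
  by move=> v Av; rewrite leNgt; apply/negP => xv; case: nA; exists v.
exists ((`|simple_height B a v1| + 1) / m); first by rewrite divr_ge0 // ltW.
move=> v Rv kv xv.
have -> : simple_height B a v = simple_height B a v1.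
  apply/eqP; rewrite -subr_eq0 -linearB /=.
  by rewrite simple_height_null //; exact: sub_null.
rewrite mulrAC ler_pdivlMr // ler_wpM2l //; exact: mP.
Qed.

Lemma height_exists :
  exists f : {scalar V}, forall v, R v -> v != 0 -> 1 <= `|f v|.
Proof.
have /choice[lam lamP] : forall k : {ffun 'I_l -> 'I_9}, exists x : K, 0 <= x /\
    forall v, Rx v -> cartan_class B a k v -> null_coord v != 0 ->
    `|simple_height B a v| + 1 <= x * `|null_coord v|.
  by move=> k; have [x x0 xP] := root_class_gap k; exists x.
have [e e0 eP] := root_line_gap d.
(* The term [e^-1] serves the isotropic roots, [lam k] the anisotropic roots of class [k] off the
   hyperplane [null_coord = 0]. *)
pose L := e^-1 + \sum_k lam k.
have lam0 k : 0 <= lam k by case: (lamP k).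
have Le : e^-1 <= L by rewrite lerDl sumr_ge0.
have Lk k : lam k <= L.
  rewrite /L (bigD1 k) //= addrCA lerDl addr_ge0 ?invr_ge0 ?(ltW e0) //.
  exact: sumr_ge0.
pose h v := simple_height B a v + L * null_coord v.
have h_lin : scalar h.
  by move=> c u v; rewrite /h !linearP /= !mulrDr mulrCA addrACA.
pose hL := GRing.isLinear.Build K V K *%R h h_lin.
pose f : {scalar V} := HB.pack h hL.
exists f => v Rv v0; rewrite -[f v]/(h v) /h.
have [viso|vaniso] := pselect (isotropic B v).
  have vV0 : v \in V0 by apply/mem_isotropic_space.
  rewrite simple_height_null // add0r normrM ger0_norm; last first.
    by apply: le_trans Le; rewrite invr_ge0 ltW.
  rewrite -(mulVf (lt0r_neq0 e0)) ler_pM // ?invr_ge0 ?(ltW e0) //.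
  by apply: eP; rewrite -(null_coordE vV0).
have Rxv : Rx v by [].
have [x0|x0] := eqVneq (null_coord v) 0.
  by rewrite x0 mulr0 addr0; exact: (simple_height_ge1 B_psd R_ears a_lift).
have [k kv] := cartan_classP B_psd R_ears a_lift Rxv.
have [_ /(_ v Rxv kv x0) hk] := lamP k.
have Lx : lam k * `|null_coord v| <= `|L * null_coord v|.
  by rewrite normrM ler_wpM2r // (le_trans (Lk k)) // ler_norm.
have := ler_normB (simple_height B a v + L * null_coord v)
  (simple_height B a v).
rewrite addrAC subrr add0r; lra.
Qed.

End SmallNullity.

Lemma small_nullity_presentation (K : realType) (V : vectType K)
    (B : {symmetric V}) (R : set V) (l : nat) (a : l.-tuple V) :
  positive_semidefinite B -> is_EARS B R -> fundamental_lift B R a ->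
  (nullity B < 2)%N -> has_coxeter_presentation B <<a>>%VS R.
Proof.
move=> B_psd R_ears a_lift /subv_line[d V0_line].
have [f fP] := height_exists B_psd R_ears a_lift V0_line.
apply: (height_coxeter_presentation B_psd R_ears fP).
  exact: nullspace_disj a_lift.
exact: nullspace_full a_lift.
Qed.

(** * Large nullity *)

Section LinkedIsotropicRoots.
Variables (K : realType) (V : vectType K) (B : {symmetric V}).
Hypothesis B_psd : positive_semidefinite B.
Variable R : set V.
Hypothesis R_ears : is_EARS B R.
Local Notation Rx := (anisotropic_roots B R).
Local Notation V0 := (isotropic_space B).

(** Otherwise (R7) fails for the roots orthogonal to [P] and the remaining ones: if [x] is
    orthogonal to [P] and [(v, y) <> 0] with [v] in [P], then [x] is orthogonal to [v] and to its
    reflection in [y], hence to [y]. *)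
Lemma stable_roots_linked (P : set V) (b : V) : P !=set0 -> P `<=` Rx ->
  (forall g v, Rx g -> P v -> P (root_refl B g v)) -> Rx b ->
  exists2 v, P v & B v b != 0.
Proof.
move=> [a Pa] PR P_refl Rb; apply: contrapT => nb.
have b_orth v : P v -> B v b = 0.
  by move=> Pv; apply/eqP; apply: contrapT => /negP vb; apply: nb; exists v.
pose R1 := [set g | Rx g /\ forall v, P v -> B v g = 0].
case: (ears_irreducible R_ears); exists R1, (Rx `\` R1); split.
- by exists b.
- exists a; split; first exact: PR.
  move=> [_ /(_ a Pa)]; apply/eqP.
  by rewrite gt_eqF // (sform_gt0 B_psd (PR _ Pa)).
- by apply/seteqP; split => // x [? []].
- apply/seteqP; split=> [x [[]|[]]//|x Rx_x].
  by have [|] := pselect (R1 x); [left|right].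
- move=> x y [_ x_orth] [Ry nR1y].
  have [v Pv vy] : exists2 v, P v & B v y != 0.
    apply: contrapT => nv; apply: nR1y; split => // v Pv.
    by apply/eqP; apply: contrapT => /negP vy; apply: nv; exists v.
  have := x_orth _ (P_refl _ _ Ry Pv).
  rewrite /root_refl sformDl sformNl sformZl x_orth // sub0r => /eqP.
  rewrite oppr_eq0 !mulf_eq0 pnatr_eq0 invr_eq0 (negbTE vy) /=.
  by rewrite gt_eqF ?(sform_gt0 B_psd Ry) //= sformC => /eqP.
Qed.

(** (R8) gives suitable [a] and [b], but possibly orthogonal. Reflections fix [s], so the roots [v]
    with [v + s] a root form a stable set, in which [a] can be replaced. *)
Lemma isotropic_roots_linked s t : isotropic_roots B R s ->
  isotropic_roots B R t -> exists a b,
  [/\ Rx a, Rx (a + s), Rx b, Rx (b + t) & B a b != 0].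
Proof.
move=> sR tR; have [[Rs s0] [Rt t0]] := (sR, tR).
have aniso_add u v : isotropic B u -> Rx v -> R (v + u) -> Rx (v + u).
  move=> u0 [_ v0] Ruv; split => //; rewrite /isotropic /=.
  rewrite sformDl !sformDr (isotropic_orth B_psd _ u0) (sformC B v u).
  by rewrite !(isotropic_orth B_psd _ u0) !addr0.
have [a [Ra Ras]] := ears_isotropic R_ears sR.
have [b [Rb Rbt]] := ears_isotropic R_ears tR.
have [|||v [Rv Rvs] vb] :=
    @stable_roots_linked [set v | Rx v /\ Rx (v + s)] b _ _ _ Rb.
- by exists a; split => //; exact: aniso_add.
- by move=> v [].
- move=> g v Rg [Rv Rvs]; split; first exact: aniso_reflP.
  have -> : root_refl B g v + s = root_refl B g (v + s).
    by rewrite /root_refl sformDl (isotropic_orth B_psd _ s0) addr0 addrAC.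
  exact: aniso_reflP.
- by exists v, b; split => //; exact: aniso_add.
Qed.

Variables (l : nat) (a : l.-tuple V).
Hypothesis a_lift : fundamental_lift B R a.

(* A root congruent to \sum_i c_i a_i modulo V^0 is handled by induction on
   \sum_i c_i: some a_i with c_i > 0 has positive product with it, so that
   subtracting a_i yields a root again. *)
Lemma root_mem_span (U : {vspace V}) :
  (forall s, isotropic_roots B R s -> s \in U) ->
  forall v, R v -> v \in (<<a>> + U)%VS.
Proof.
move=> sU; have isoU s : R s -> isotropic B s -> s \in (<<a>> + U)%VS.
  by move=> Rs s0; rewrite -[s]add0r memv_add ?mem0v // sU.
suff pos n : forall (c : 'I_l -> nat) v, R v -> (\sum_i c i = n)%N ->
    v - \sum_i tnth a i *+ c i \in V0 -> v \in (<<a>> + U)%VS.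
  move=> v Rv; have [v0|v0] := pselect (isotropic B v); first exact: isoU.
  have [c [] cE] := root_coords a_lift (conj Rv v0); first exact: (pos _ c).
  by rewrite -memvN; apply: (pos _ c) => //; exact: (root_opp R_ears).
elim: n => [|n IH] c v Rv cn cE.
  apply: isoU => //; apply/mem_isotropic_space => //; move: cE.
  rewrite big1 ?subr0 // => i _; move/eqP: cn; rewrite sum_nat_eq0.
  by move=> /forallP/(_ i)/eqP ->.
have [v0|v0] := pselect (isotropic B v); first exact: isoU.
have Rv' : Rx v by [].
have [i ci vi] : exists2 i, (0 < c i)%N & 0 < B v (tnth a i).
  apply: contrapT => ni; have := sform_gt0 B_psd Rv'.
  rewrite -{2}[v](subrK (\sum_i tnth a i *+ c i)) sformDr sformC.
  rewrite isotropic_sform0 // add0r linear_sumr /= ltNge => /negP; apply.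
  apply: sumr_le0 => i _; rewrite linearMnr.
  have [->|ci] := posnP (c i); first by rewrite mulr0n.
  by rewrite pmulrn_lle0 // leNgt; apply/negP => vi; apply: ni; exists i.
have Rai : Rx (tnth a i) by case: a_lift.
rewrite -[v](subrK (tnth a i)) memvD //; last first.
  by rewrite -[tnth a i]addr0 memv_add ?mem0v // memv_span // mem_tnth.
(* The truncated subtraction is exact because [0 < c i]. *)
apply: (IH (fun j => (c j - (j == i))%N)).
- exact: root_sub.
- move: cn; rewrite (bigD1 i) //= [in X in _ -> X](bigD1 i) //= eqxx.
  have -> : (\sum_(j < l | j != i) (c j - (j == i)) =
             \sum_(j < l | j != i) c j)%N.
    by apply: eq_bigr => j /negbTE ->; rewrite subn0.
  by rewrite subn1; case: (c i) ci => // k _ [].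
- rewrite -addrA -opprD; suff <- : \sum_i tnth a i *+ c i =
      tnth a i + \sum_j tnth a j *+ (c j - (j == i)) by [].
  rewrite (bigD1 i) //= [in RHS](bigD1 i) //= eqxx.
  have -> : \sum_(j < l | j != i) tnth a j *+ (c j - (j == i)) =
            \sum_(j < l | j != i) tnth a j *+ c j.
    by apply: eq_bigr => j /negbTE ->; rewrite subn0.
  by rewrite addrA -mulrS subn1 prednK.
Qed.

(** If the isotropic roots lay on one line, [root_mem_span] and (R3) would make [V] the sum of
    [<<a>>] and that line, leaving dimension at most 1 for [V^0]. *)
Lemma independent_isotropic_roots : (1 < nullity B)%N -> exists s t,
  [/\ isotropic_roots B R s, isotropic_roots B R t, s != 0 & t \notin <[s]>%VS].
Proof.
move=> nu2; apply: contrapT => nst.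
have [s sP] : exists s, forall t, isotropic_roots B R t -> t \in <[s]>%VS.
  have [[s [Rs s0]]|ns] := pselect (exists s, isotropic_roots B R s /\ s != 0).
    exists s => t Rt; apply: contrapT => /negP ts; apply: nst.
    by exists s, t.
  exists 0 => t Rt; have [->|t0] := eqVneq t 0; first exact: mem0v.
  by case: ns; exists t.
have := ears_span R_ears (root_mem_span sP) => full.
have dE := dimv_disjoint_sum (nullspace_disj a_lift).
have := (dimv_add_leqif <<a>>%VS <[s]>%VS).1.
rewrite full -(nullspace_full a_lift) dE addnC leq_add2l dim_vline.
by rewrite leqNgt (leq_ltn_trans _ nu2) // leq_b1.
Qed.

End LinkedIsotropicRoots.

(** * Commutators of products of two reflections *)

Section CentralCommutator.
Variable K : realType.

Let v2rD (E : vectType K) (u v : E) : v2r (u + v) = v2r u + v2r v.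
Proof. exact: raddfD. Qed.

Let v2rN (E : vectType K) (u : E) : v2r (- u) = - v2r u.
Proof. exact: raddfN. Qed.

Let v2rZ (E : vectType K) c (u : E) : v2r (c *: u) = c *: v2r u.
Proof. exact: linearZ. Qed.

Lemma double_refl_combine (E : vectType K) (v a s : E) (p x y : K) :
  v - (p * x) *: a - (p * (x + y - 2%:R * x)) *: (a + s) =
  v - (p * y) *: (a + s) + (p * x) *: s.
Proof.
apply: v2r_inj; apply/rowP => i.
rewrite !(v2rD, v2rN, v2rZ) !mxE; ring.
Qed.

Lemma commutator_combine (E : vectType K) (v a b s t : E)
    (p q c vs vt va vb : K) :
  v - (q * vt) *: (b + t) + (q * vb) *: t - (p * vs) *: (a + s) +
    (p * (va - q * vt * c)) *: s =
  v - (p * vs) *: (a + s) + (p * va) *: s - (q * vt) *: (b + t) +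
    (q * (vb - p * vs * c)) *: t + (p * q * c) *: (vs *: t - vt *: s).
Proof.
apply: v2r_inj; apply/rowP => i.
rewrite !(v2rD, v2rN, v2rZ) !mxE; ring.
Qed.

Variables (V : vectType K) (B : {symmetric V}).
Variable Vdot : {vspace V}.
Local Notation H := (hyperbolic B Vdot).
Local Notation r := (@reflection K V B Vdot).
Local Notation form := (@hform K V B Vdot).

(** For [s] isotropic and orthogonal to [a], this is the Eichler transvection of [s] and the coroot
    [2 a / <a,a>]. *)
Definition double_refl (a s : H) := (r (a + s) * r a)%g.

Lemma double_reflE a s v : form s s = 0 -> form a s = 0 -> form a a != 0 ->
  aut_val (double_refl a s) v =
  v - (2%:R / form a a * form v s) *: (a + s)
    + (2%:R / form a a * form v a) *: s.
Proof.
move=> ss as0 aa; rewrite autM !reflectionE.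
set p := 2%:R / form a a.
have -> : form (a + s) (a + s) = form a a.
  by rewrite hformDl !hformDr (hformC s a) ss as0 !addr0.
have pE x : 2%:R * (x / form a a) = p * x by rewrite /p; field.
rewrite !pE hformDl hformNl hformZl !hformDr as0 addr0.
have paa : p * form v a * form a a = 2%:R * form v a by rewrite /p; field.
by rewrite paa double_refl_combine.
Qed.

Lemma hform_double_refl a s v w : form s s = 0 -> form a s = 0 ->
  form a a != 0 -> form s w = 0 ->
  form (aut_val (double_refl a s) v) w =
  form v w - 2%:R / form a a * form v s * form a w.
Proof.
move=> ss as0 aa sw; rewrite double_reflE //.
rewrite !(hformDl, hformNl, hformZl) sw; ring.
Qed.

(** With [u] the image of [v] under the product in one order, the two orders are compared on [v].
    Both factors preserve pairings with [s] and [t], so the correction can be written in terms of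
    [u]. *)
Lemma double_refl_commutator a b s t u :
  form s s = 0 -> form t t = 0 -> form s t = 0 ->
  form a s = 0 -> form a t = 0 -> form b s = 0 -> form b t = 0 ->
  form a a != 0 -> form b b != 0 ->
  aut_val (double_refl a s * double_refl b t *
           (double_refl b t * double_refl a s)^-1)%g u =
  u + (2%:R / form a a * (2%:R / form b b) * form a b) *:
        (form u s *: t - form u t *: s).
Proof.
move=> ss tt st sa ta sb tb aa bb; rewrite autM; set v := aut_val _^-1%g u.
have uE : u = aut_val (double_refl b t * double_refl a s)%g v by rewrite autKV.
have us : form u s = form v s.
  rewrite uE autM !hform_double_refl // ?(hformC t s) //.
  by rewrite sa sb !mulr0 !subr0.
have ut : form u t = form v t.
  rewrite uE autM !hform_double_refl //.
  by rewrite ta tb !mulr0 !subr0.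
rewrite us ut uE (autM (double_refl a s)) (autM (double_refl b t)).
rewrite (double_reflE (aut_val (double_refl b t) v)) //.
rewrite (double_reflE (aut_val (double_refl a s) v)) //.
rewrite (hform_double_refl v (w := s)) ?(hformC t s) //.
rewrite (hform_double_refl v (w := a)) ?(hformC t a) //.
rewrite (hform_double_refl v (w := t)) //.
rewrite (hform_double_refl v (w := b)) ?(hformC s b) //.
rewrite sb ta (hformC b a) !mulr0 !subr0 !double_reflE //.
exact: commutator_combine.
Qed.

End CentralCommutator.

(** Taken for [U = V^0], such a form is a vector of the dual summand whose pairing reads off a
    coordinate of an isotropic root. *)
Lemma subvs_coord_form (K : realType) (V : vectType K) (U : {vspace V}) j :
  exists phi : 'Hom(subvs_of U, K^o), forall x, phi x = v2r (vsval x) 0 j.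
Proof.
pose h (x : subvs_of U) : K^o := v2r (vsval x) 0 j.
have h_lin : linear h by move=> c u v; rewrite /h !linearP !mxE.
pose hL := GRing.isLinear.Build K (subvs_of U) K^o *:%R h h_lin.
pose phi : {linear subvs_of U -> K^o} := HB.pack h hL.
by exists (linfun phi) => x; rewrite lfunE.
Qed.

Lemma large_nullity_no_presentation (K : realType) (V : vectType K)
    (B : {symmetric V}) (R : set V) (l : nat) (a : l.-tuple V) :
  positive_semidefinite B -> is_EARS B R -> fundamental_lift B R a ->
  (1 < nullity B)%N -> ~ has_coxeter_presentation B <<a>>%VS R.
Proof.
move=> B_psd R_ears a_lift nu2 [S [_ cox]].
have V_disj := nullspace_disj a_lift; have V_full := nullspace_full a_lift.
have [s [t [sR tR s0 ts]]] :=
  independent_isotropic_roots B_psd R_ears a_lift nu2.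
have [x [y [Rx Rxs Ry Ryt xy]]] := isotropic_roots_linked B_psd R_ears sR tR.
pose Vd := <<a>>%VS; pose i := @hincl K V B Vd.
pose r v := @reflection K V B Vd (i v).
pose form := @hform K V B Vd.
pose W := @weyl_group K V B Vd R.
have formE u v : form (i u) (i v) = B u v by exact: hform_hincl.
have orth u w : isotropic_roots B R w -> form (i u) (i w) = 0.
  by move=> [_ w0]; rewrite formE sformC isotropic_orth.
have aniso v : anisotropic_roots B R v -> form (i v) (i v) != 0.
  by move=> Rv; rewrite formE gt_eqF // (sform_gt0 B_psd Rv).
have [W1 WM WV] : is_subgroup W.
  split; first by move=> G [[]].
    by move=> g h Wg Wh G GP; case: (GP) => -[_ GM _] _; apply: GM;
      [exact: Wg|exact: Wh].
  by move=> g Wg G GP; case: (GP) => -[_ _ GV] _; apply: GV; exact: Wg.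
have rE v w : aut_val (r v) (i w) = i (root_refl B v w).
  exact: reflection_hincl.
have root_refl_isotropic v w : isotropic B w -> root_refl B v w = w.
  move=> w0; rewrite /root_refl isotropic_orth //.
  by rewrite mul0r mulr0 scale0r subr0.
have Wr v : anisotropic_roots B R v -> W (r v).
  by move=> Rv G [_]; apply; exists v.
(* These properties pass to products and inverses, so checking the generators is enough; they say
   that [w] preserves everything entering the formula for [z]. *)
have W_fix w : W w -> [/\ isometry w, aut_val w (i s) = i s
    & aut_val w (i t) = i t].
  move: w; apply: smallest_sub.
    split.
    - by split; rewrite ?aut1 //; exact: isometry1.
    - move=> g h [gI gs gt] [hI hs ht]; split; last 2 first.
      + by rewrite autM hs gs.
      + by rewrite autM ht gt.
      exact: isometryM.
    - move=> g [gI gs gt]; split; last 2 first.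
      + by rewrite -{1}gs autVK.
      + by rewrite -{1}gt autVK.
      by move=> u v; rewrite -gI !autKV.
  move=> _ [v Rv <-]; split; first exact: isometry_reflection.
    by apply: etrans (rE v s) _; rewrite root_refl_isotropic //; case: sR.
  by apply: etrans (rE v t) _; rewrite root_refl_isotropic //; case: tR.
pose t1 := double_refl (i x) (i s); pose t2 := double_refl (i y) (i t).
have Wt1 : W t1.
  by apply: WM; [rewrite -[i x + i s]linearD; exact: Wr|exact: Wr].
have Wt2 : W t2.
  by apply: WM; [rewrite -[i y + i t]linearD; exact: Wr|exact: Wr].
pose k := 2%:R / form (i x) (i x) * (2%:R / form (i y) (i y)) *
  form (i x) (i y).
have k0 : k != 0.
  by rewrite !mulf_neq0 ?invr_eq0 ?aniso ?pnatr_eq0 // formE.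
have [z Wz zE] : exists2 z, W z & forall u, aut_val z u =
    u + k *: (form u (i s) *: i t - form u (i t) *: i s).
  exists (t1 * t2 * (t2 * t1)^-1)%g.
    exact: (WM _ _ (WM _ _ Wt1 Wt2) (WV _ (WM _ _ Wt2 Wt1))).
  move=> u; apply: double_refl_commutator;
    first [exact: (orth _ _ sR) | exact: (orth _ _ tR) | exact: aniso].
clearbody k; have zC w : W w -> (w * z = z * w)%g.
  move=> /W_fix[wI ws wt]; apply: aut_ext => u; rewrite !autM !zE.
  have wus : form (aut_val w u) (i s) = form u (i s).
    by rewrite -{1}ws; exact: wI.
  have wut : form (aut_val w u) (i t) = form u (i t).
    by rewrite -{1}wt; exact: wI.
  have wD x' y' : aut_val w (x' + y') = aut_val w x' + aut_val w y'.
    exact: linearD.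
  have wZ c x' : aut_val w (c *: x') = c *: aut_val w x' by exact: linearZ.
  by rewrite wus wut -!scaleNr !(wD, wZ) ws wt.
have zz := coxeter_center_involutive cox Wz zC.
have [zI zs zt] := W_fix _ Wz.
(* Since [z] preserves pairings with [s] and [t], its square doubles the displacement, and
   [z * z = 1] with [k != 0] makes it vanish. *)
have st_dep u : form u (i s) *: i t = form u (i t) *: i s.
  have zus : form (aut_val z u) (i s) = form u (i s).
    by rewrite -{1}zs; exact: zI.
  have zut : form (aut_val z u) (i t) = form u (i t).
    by rewrite -{1}zt; exact: zI.
  have := aut1 u; rewrite -zz autM zE zus zut zE -addrA => /eqP.
  rewrite -subr_eq0 addrAC subrr add0r -mulr2n -scaler_nat !scaler_eq0.
  by rewrite pnatr_eq0 (negbTE k0) /= subr_eq0 => /eqP.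
(* Testing [st_dep] on a vector of the dual summand turns the pairings into coordinates of [s] and
   [t]; a nonzero coordinate of [s] then puts [t] on its line. *)
have coord_dep j : v2r s 0 j *: t = v2r t 0 j *: s.
  have [phi phiE] := subvs_coord_form (isotropic_space B) j.
  have formphi w : isotropic_roots B R w -> form (0, 0, phi) (i w) = v2r w 0 j.
    move=> [_ /(mem_isotropic_space B_psd) w0].
    rewrite /form /hform /= phiE lfunE /= add0r.
    rewrite (_ : B _ _ = 0) ?add0r; last exact: sform0l.
    by rewrite vsprojK ?memv_pi // daddv_pi_id.
  have iZ c v : i (c *: v) = c *: i v by exact: linearZ.
  apply: (hincl_inj V_disj V_full); rewrite -/i !iZ.
  by have := st_dep (0, 0, phi); rewrite !formphi.
have [j sj] : exists j, v2r s 0 j != 0.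
  apply: contrapT => nj; case/eqP: s0; apply: v2r_inj; rewrite linear0.
  apply/rowP => j; rewrite mxE; apply/eqP; apply: contrapT => /negP sj.
  by apply: nj; exists j.
case/vlineP: ts; exists ((v2r s 0 j)^-1 * v2r t 0 j).
by rewrite -scalerA -coord_dep scalerA mulVf // scale1r.
Qed.

Theorem theorem2p9 (K : realType) (V : vectType K) (B : {symmetric V})
    (B_psd : positive_semidefinite B) (R : set V) (R_ears : is_EARS B R)
    (l : nat) (a : l.-tuple V) (a_lift : fundamental_lift B R a) :
  has_coxeter_presentation B <<a>>%VS R <-> (nullity B < 2)%N.
Proof.
split; last exact: (small_nullity_presentation B_psd R_ears a_lift).
move=> cox; rewrite ltnNge; apply/negP => nu2.
exact: (large_nullity_no_presentation B_psd R_ears a_lift nu2 cox).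
Qed.
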